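(* Let $\mathbb{k}$ be an infinite field, $R=\mathbb{k}[x_1,\dots,x_d]$ a polynomial ring, and $I$ a nonzero ideal generated by monomials $f_1,\dots,f_u$ of the same degree $\delta$. Let $\ell$ be the analytic spread of $I$, let $\underline z=\{z_{ij}\mid 1\leqslant i\leqslant\ell,\ 1\leqslant j\leqslant u\}$ be variables over $R$, and let $J$ be the ideal of $R[\underline z]$ generated by $b_i=\sum_{j=1}^u z_{ij}f_j$, $1\leqslant i\leqslant \ell$. Let $h\in\mathbb{k}[\underline z]$ be an irreducible polynomial generating the ideal $\mathcal{A}=(\mathcal{H}:_{\mathcal{F}[\underline z]}\mathcal{F}_+^\infty)\cap\mathbb{k}[\underline z]$. Then $$\left(\operatorname{mono}(J):_{R[\underline z]}(h)^\infty\right)\cap R\subseteq\operatorname{gradedcore}(I).$$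
   Context: $\mathfrak m=(x_1,\dots,x_d)$. $\mathcal{F}=\bigoplus_{n\geqslant0}I^n/\mathfrak m I^n$ is the special fiber ring of $I$ (since $I$ is generated in one degree it is identified with the subalgebra $\mathbb{k}[I_\delta]=\mathbb{k}[f_1,\dots,f_u]$ of $R$), $\mathcal{F}_+$ is its ideal generated by elements of positive degree, and $\ell=\dim\mathcal{F}$. $\mathcal{H}$ is the ideal of $\mathcal{F}[\underline z]$ generated by $b_1,\dots,b_\ell$, where the $f_j$ are viewed as elements of degree 1 of $\mathcal{F}$. The ideal $\mathcal{A}$ is a prime ideal of height one of $\mathbb{k}[\underline z]$, hence principal generated by an irreducible polynomial $h$. For ideals $L, H$: $L:H^\infty=\bigcup_n (L:H^n)$. For an ideal $L$ of $R[\underline z]=\mathbb{k}[\underline z][x_1,\dots,x_d]$, $\operatorname{mono}(L)$ is the ideal generated by all elements of $L$ of the form $a\,m$ with $a\in\mathbb{k}[\underline z]$ and $m$ a monomial in $x_1,\dots,x_d$. A subideal $J'\subseteq I$ is a reduction of $I$ if $I^{m+1}=J'I^m$ for $m\gg0$; $\operatorname{gradedcore}(I)$ is the intersection of all homogeneous reductions of $I$. *)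

(* Defs.v *)
From HB Require Import structures.
From mathcomp Require Import all_boot all_order all_algebra.
From mathcomp Require Import boolp.
From mathcomp Require Import mpoly.

Set Implicit Arguments.
Unset Strict Implicit.
Unset Printing Implicit Defensive.

Import GRing.Theory.
Local Open Scope ring_scope.
Local Open Scope quotient_scope.

(* Ideals of a commutative ring are handled as Prop-valued predicates. *)
Section Ideals.
Variable A : comNzRingType.
Implicit Types (P Q L H G : A -> Prop).

Definition is_ideal P : Prop :=
  P 0 /\ forall a x y, P x -> P y -> P (a * x + y).

Definition ideal_gen G : A -> Prop := fun x =>
  exists (n : nat) (a g : 'I_n -> A),
    (forall i, G (g i)) /\ x = \sum_i a i * g i.

Definition ideal_mul P Q : A -> Prop :=
  ideal_gen (fun x => exists p q, [/\ P p, Q q & x = p * q]).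

Fixpoint ideal_pow P (n : nat) : A -> Prop :=
  if n is n'.+1 then ideal_mul P (ideal_pow P n') else fun=> True.

Definition ideal_eq P Q : Prop := forall x, P x <-> Q x.

Definition colon_sat L H : A -> Prop := fun x =>
  exists n : nat, forall y, ideal_pow H n y -> L (x * y).

Definition is_prime_ideal P : Prop :=
  [/\ is_ideal P, ~ P 1 & forall x y, P (x * y) -> P x \/ P y].

Definition prime_chain (n : nat) (C : nat -> A -> Prop) : Prop :=
  (forall i, (i <= n)%N -> is_prime_ideal (C i)) /\
  (forall i, (i < n)%N ->
     (forall x, C i x -> C i.+1 x) /\ (exists x, C i.+1 x /\ ~ C i x)).

Definition has_krull_dim (n : nat) : Prop :=
  (exists C, prime_chain n C) /\
  (forall m C, prime_chain m C -> (m <= n)%N).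

Lemma ideal_gen_ideal G : is_ideal (ideal_gen G).
Proof.
split.
  by exists 0%N, (fun=> 0), (fun=> 0); split; [case | rewrite big_ord0].
move=> c x y [n [a [g [Gg ->]]]] [m [b [h [Gh ->]]]].
exists (n + m)%N.
exists (fun i => match split i with inl j => c * a j | inr k => b k end).
exists (fun i => match split i with inl j => g j | inr k => h k end).
split; first by move=> i; case: (split i).
rewrite big_split_ord /= mulr_sumr; congr (_ + _); apply: eq_bigr => i _.
  by rewrite (unsplitK (inl i)) mulrA.
by rewrite (unsplitK (inr i)).
Qed.

Lemma ideal_gen_sub G P : is_ideal P -> (forall x, G x -> P x) ->
  forall x, ideal_gen G x -> P x.
Proof.
move=> [P0 PD] GP x [n [a [g [Gg ->]]]].
elim/big_rec: _ => // i y _ Py; exact/PD/Py/GP/Gg.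
Qed.

Lemma mem_ideal_gen G x : G x -> ideal_gen G x.
Proof.
by move=> Gx; exists 1%N, (fun=> 1), (fun=> x); rewrite big_ord1 mul1r.
Qed.

Lemma mem_ideal_mul P Q x y : P x -> Q y -> ideal_mul P Q (x * y).
Proof. by move=> Px Qy; apply: mem_ideal_gen; exists x, y. Qed.

Lemma ideal_mul_ideal P Q : is_ideal (ideal_mul P Q).
Proof. exact: ideal_gen_ideal. Qed.

Lemma ideal_pow_ideal P n : is_ideal (ideal_pow P n).
Proof. by case: n => [|n]; [split | apply: ideal_mul_ideal]. Qed.

Lemma is_ideal_mull P a x : is_ideal P -> P x -> P (a * x).
Proof. by move=> [P0 PD] Px; rewrite -[a * x]addr0; apply: PD. Qed.

Lemma is_idealN P x : is_ideal P -> P x -> P (- x).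
Proof. by move=> iP Px; rewrite -mulN1r; apply: is_ideal_mull. Qed.

Lemma is_idealD P x y : is_ideal P -> P x -> P y -> P (x + y).
Proof. by move=> [P0 PD] Px Py; rewrite -[x]mul1r; apply: PD. Qed.

Lemma is_ideal_sum P I (r : seq I) (C : pred I) (F : I -> A) : is_ideal P ->
  (forall i, C i -> P (F i)) -> P (\sum_(i <- r | C i) F i).
Proof.
move=> iP PF; elim/big_ind: _ => //; first by case: iP.
by move=> x y; apply: is_idealD.
Qed.

Lemma ideal_powD P m n x y :
  ideal_pow P m x -> ideal_pow P n y -> ideal_pow P (m + n) (x * y).
Proof.
elim: m x => [|m IH] x Px Py.
  by apply: is_ideal_mull Py; apply: ideal_pow_ideal.
have [k [a [g [Gg ->]]]] := Px; rewrite mulr_suml.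
apply: is_ideal_sum; first exact: ideal_pow_ideal.
move=> i _; rewrite -mulrA; apply: is_ideal_mull.
  exact: (@ideal_pow_ideal P (m.+1 + n)).
have [p [q [Pp Pq ->]]] := Gg i; rewrite -mulrA.
by apply: mem_ideal_mul => //; apply: IH.
Qed.

Lemma ideal_mul_pow P m n Q x y : ideal_pow P m x ->
  ideal_mul Q (ideal_pow P n) y ->
  ideal_mul Q (ideal_pow P (m + n)) (x * y).
Proof.
move=> Px [k [a [g [Gg ->]]]]; rewrite mulr_sumr.
apply: is_ideal_sum; first exact: ideal_mul_ideal.
move=> i _; rewrite mulrCA; apply: is_ideal_mull; first exact: ideal_mul_ideal.
have [p [q [Qp Pq ->]]] := Gg i; rewrite mulrCA.
by apply: mem_ideal_mul => //; apply: ideal_powD.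
Qed.

End Ideals.

Definition irreducible_elt (A : comUnitRingType) (h : A) : Prop :=
  [/\ h != 0, h \isn't a GRing.unit &
      forall a b : A, h = a * b ->
        (a \is a GRing.unit) \/ (b \is a GRing.unit)].

Section PolyIdeals.
Variables (K : fieldType) (d : nat).
Local Notation R := {mpoly K[d]}.
Implicit Types I J : R -> Prop.

Definition max_ideal : R -> Prop := ideal_gen (fun x => exists i, x = 'X_i).

Lemma max_ideal_coeff0 x : max_ideal x -> x@_0%MM = 0.
Proof.
move=> mx; apply: (ideal_gen_sub (P := fun x : R => x@_0%MM = 0)) mx.
  split; first exact: mcoeff0.
  move=> a p q p0 q0; rewrite mcoeffD q0 addr0.
  have /(congr1 (fun z : K => a@_0%MM * z)) := p0; rewrite mulr0 => <-.
  exact: (@rmorphM _ _ (@mcoeff d K 0%MM)).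
by move=> _ [i ->]; rewrite mcoeffX mnm1_eq0.
Qed.

Definition is_homogeneous_ideal J : Prop :=
  is_ideal J /\ forall p n, J p -> J (pihomog mdeg n p).

Definition is_reduction I J : Prop :=
  [/\ is_ideal J, forall p, J p -> I p &
      exists m0 : nat, forall m : nat, (m0 <= m)%N ->
        ideal_eq (ideal_pow I m.+1) (ideal_mul J (ideal_pow I m))].

Definition gradedcore I : R -> Prop := fun p =>
  forall J, is_homogeneous_ideal J -> is_reduction I J -> J p.

End PolyIdeals.

(* The Rees algebra \bigoplus_n I^n t^n, as a subring of R[t], and the special
   fiber ring \bigoplus_n I^n / m I^n, as its quotient by the ideal
   \bigoplus_n m I^n t^n. *)
Section FiberRing.
Variables (K : fieldType) (d : nat) (I : {mpoly K[d]} -> Prop).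
Local Notation R := {mpoly K[d]}.

Definition rees_pred : {pred {poly R}} :=
  fun p => `[< forall n, ideal_pow I n p`_n >].

Lemma rees_predP (p : {poly R}) :
  reflect (forall n, ideal_pow I n p`_n) (p \in rees_pred).
Proof. exact: asboolP. Qed.

Lemma rees_subring : subring_closed rees_pred.
Proof.
split.
- apply/rees_predP => -[|n] //=; rewrite coefC /=.
  by case: (ideal_pow_ideal I n.+1).
- move=> p q /rees_predP Ip /rees_predP Iq; apply/rees_predP => n.
  have iI := ideal_pow_ideal I n.
  by rewrite coefB; apply: is_idealD => //; apply: is_idealN.
- move=> p q /rees_predP Ip /rees_predP Iq; apply/rees_predP => n.
  rewrite coefM; apply: is_ideal_sum => [|i _]; first exact: ideal_pow_ideal.
  have := ideal_powD (Ip i) (Iq (n - i)%N).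
  by rewrite subnKC // -ltnS.
Qed.

HB.instance Definition _ := GRing.isSubringClosed.Build {poly R} rees_pred
  rees_subring.

Record rees := Rees { rees_val :> {poly R}; rees_valP : rees_val \in rees_pred }.

HB.instance Definition _ := [isSub for rees_val].
HB.instance Definition _ := [Choice of rees by <:].
HB.instance Definition _ := [SubChoice_isSubComNzRing of rees by <:].

Definition fiber_ker : {pred rees} :=
  fun p => `[< forall n,
    ideal_mul (@max_ideal K d) (ideal_pow I n) (rees_val p)`_n >].

Lemma fiber_kerP (p : rees) :
  reflect (forall n, ideal_mul (@max_ideal K d) (ideal_pow I n)
                       (rees_val p)`_n)
          (p \in fiber_ker).
Proof. exact: asboolP. Qed.

Lemma fiber_ker_idealr : idealr_closed fiber_ker.
Proof.
split.
- apply/fiber_kerP => n; rewrite [rees_val 0]rmorph0 coef0.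
  by case: (ideal_mul_ideal (@max_ideal K d) (ideal_pow I n)).
- apply/negP => /fiber_kerP /(_ 0%N); rewrite [rees_val 1]rmorph1 coefC /=.
  move=> m1; have /max_ideal_coeff0 : @max_ideal K d 1.
    apply: ideal_gen_sub m1; first exact: ideal_gen_ideal.
    move=> _ [p [q [mp _ ->]]]; rewrite mulrC.
    by apply: is_ideal_mull mp; apply: ideal_gen_ideal.
  by rewrite mcoeff1 eqxx => /eqP; rewrite oner_eq0.
- move=> a u v /fiber_kerP ku /fiber_kerP kv; apply/fiber_kerP => n.
  have -> : rees_val (a * u + v) = rees_val a * rees_val u + rees_val v by [].
  rewrite coefD coefM.
  apply: is_idealD => //; first exact: ideal_mul_ideal.
  apply: is_ideal_sum => [|i _]; first exact: ideal_mul_ideal.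
  have := ideal_mul_pow (elimT (rees_predP _) (rees_valP a) i) (ku (n - i)%N).
  by rewrite subnKC // -ltnS.
Qed.

HB.instance Definition _ := isIdealr.Build rees fiber_ker fiber_ker_idealr.

Definition fiber : comNzRingType := {ideal_quot fiber_ker}.

Lemma rees_monom_subproof n c : ideal_pow I n c -> c *: 'X^n \in rees_pred.
Proof.
move=> Ic; apply/rees_predP => m; rewrite coefZ coefXn.
have [->|_] := eqVneq m n; first by rewrite mulr1.
by rewrite mulr0; case: (ideal_pow_ideal I m).
Qed.

(* The class in I^n / m I^n, the degree n component, of an element of I^n. *)
Definition fiber_class n c (Ic : ideal_pow I n c) : fiber :=
  \pi_({ideal_quot fiber_ker}) (Rees (rees_monom_subproof Ic)).

Lemma fiber_class_eq0 n c (Ic : ideal_pow I n c) :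
  fiber_class Ic = 0 <-> ideal_mul (@max_ideal K d) (ideal_pow I n) c.
Proof.
rewrite /fiber_class -[0](rmorph0 (\pi_({ideal_quot fiber_ker}))); split.
  move=> /eqP; rewrite -Quotient.idealrBE subr0 => /fiber_kerP /(_ n) /=.
  by rewrite coefZ coefXn eqxx mulr1.
move=> mc; apply/eqP; rewrite -Quotient.idealrBE subr0; apply/fiber_kerP => m /=.
rewrite coefZ coefXn; case: eqVneq => [->|_]; rewrite ?mulr1 // mulr0.
exact: (ideal_mul_ideal _ _).1.
Qed.

Lemma fiber_classM n c (Ic : ideal_pow I n c) m e (Ie : ideal_pow I m e) :
  fiber_class Ic * fiber_class Ie = fiber_class (ideal_powD Ic Ie).
Proof.
rewrite /fiber_class -rmorphM; congr (\pi_(_) _); apply: val_inj.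
change (c *: 'X^n * (e *: 'X^m) = (c * e) *: 'X^(n + m) :> {poly R}).
by rewrite -scalerAl -scalerAr scalerA exprD.
Qed.

Definition fiber_scalar (a : K) : fiber :=
  @fiber_class 0 (a%:MP_[d]) Logic.I.

Definition fiber_plus : fiber -> Prop :=
  ideal_gen (fun x => exists n c (Ic : ideal_pow I n c),
    (0 < n)%N /\ x = fiber_class Ic).

Definition analytic_spread_is (l : nat) : Prop := has_krull_dim fiber l.

End FiberRing.

Lemma ideal_pow1 (A : comNzRingType) (P : A -> Prop) x :
  P x -> ideal_pow P 1 x.
Proof. by move=> Px; rewrite -[x]mulr1; apply: mem_ideal_mul. Qed.

Section GenericReduction.
Variables (K : fieldType) (d u l : nat) (f : 'I_u -> 'X_{1..d}).

Definition mono_ideal : {mpoly K[d]} -> Prop :=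
  ideal_gen (fun x => exists j, x = 'X_[f j]).

Lemma mono_ideal_gen j : mono_ideal 'X_[f j].
Proof. by apply: mem_ideal_gen; exists j. Qed.

(* k[z], where z_ij, for i < l and j < u, is the variable of index
   mxvec_index i j; then R[z] is encoded as k[z][x_1, ..., x_d]. *)

Definition zvar (i : 'I_l) (j : 'I_u) : {mpoly K[l * u]} :=
  'X_(mxvec_index i j).

Definition R_to_Rz : {mpoly K[d]} -> {mpoly {mpoly K[l * u]}[d]} :=
  map_mpoly (fun c => c%:MP_[l * u]).

Definition J_gen (i : 'I_l) : {mpoly {mpoly K[l * u]}[d]} :=
  \sum_(j < u) (zvar i j)%:MP_[d] * 'X_[f j].

Definition J_ideal : {mpoly {mpoly K[l * u]}[d]} -> Prop :=
  ideal_gen (fun x => exists i, x = J_gen i).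

Definition mono (L : {mpoly {mpoly K[l * u]}[d]} -> Prop) :
    {mpoly {mpoly K[l * u]}[d]} -> Prop :=
  ideal_gen (fun x => L x /\
    exists (a : {mpoly K[l * u]}) (m : 'X_{1..d}), x = a *: 'X_[m]).

Local Notation F := (fiber mono_ideal).

Definition kz_to_Fz : {mpoly K[l * u]} -> {mpoly F[l * u]} :=
  map_mpoly (@fiber_scalar K d mono_ideal).

Definition fiber_gen (j : 'I_u) : F := fiber_class (ideal_pow1 (mono_ideal_gen j)).

Definition H_gen (i : 'I_l) : {mpoly F[l * u]} :=
  \sum_(j < u) (fiber_gen j)%:MP_[l * u] * 'X_(mxvec_index i j).

Definition H_ideal : {mpoly F[l * u]} -> Prop :=
  ideal_gen (fun x => exists i, x = H_gen i).

Definition fiber_plus_ext : {mpoly F[l * u]} -> Prop :=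
  ideal_gen (fun x => exists2 c, fiber_plus c & x = c%:MP_[l * u]).

Definition A_ideal : {mpoly K[l * u]} -> Prop := fun a =>
  colon_sat H_ideal fiber_plus_ext (kz_to_Fz a).

End GenericReduction.

Arguments max_ideal K d _ : clear implicits.
Arguments mono_ideal K {d u} f _ : assert.
Arguments R_to_Rz {K d} u l _ : assert.
Arguments J_ideal K {d u} l f _ : assert.
Arguments A_ideal K {d u} l f _ : assert.

(* Main.v *)
From HB Require Import structures.
Require Import Defs.
From mathcomp Require Import all_boot all_order all_algebra.
From mathcomp Require Import boolp classical_sets.
From mathcomp Require Import mpoly.
From mathcomp Require Import ring.

(* If [h^N r] lies in [mono J], hence in [J], specializing [z] to a point [a]
   with [h a <> 0] puts [r] in the ideal of the [sum_j a_ij f_j]; so it suffices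
   to find, for a homogeneous reduction [J'] of [I], such an [a] whose rows give
   elements of [J'].  The degree [delta] part [V] of [J'] generates an ideal of
   the special fiber ring [F] containing all forms of large degree.  As the base
   field is infinite, [l = dim F] elements of [V] have the same property: while
   there are more than [l] of them, they satisfy a homogeneous relation, which
   after a linear change of coordinates makes one of them redundant.  Finally,
   if the linear forms at [a] generate all forms of large degree, Nakayama's
   lemma yields an element of [A] not vanishing at [a], and it is a multiple of
   [h]. *)

Set Implicit Arguments.
Unset Strict Implicit.
Unset Printing Implicit Defensive.

Import GRing.Theory.
Local Open Scope ring_scope.
Local Open Scope quotient_scope.

(** * Krull dimension and integral extensions *)

Section PrimeChains.
Variable A : comNzRingType.
Implicit Types (P S : A -> Prop) (xs : seq A).

Definition ideal_add P (x : A) : A -> Prop := fun y => exists p a, P p /\ y = p + a * x.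

Lemma ideal_add_ideal P x : is_ideal P -> is_ideal (ideal_add P x).
Proof.
move=> iP; split; first by exists 0, 0; rewrite mul0r addr0; case: iP.
move=> c _ _ [p [a [Pp ->]]] [q [b [Pq ->]]].
exists (c * p + q), (c * a + b); split; first by case: iP => _; apply.
by ring.
Qed.

Lemma ideal_add_sub P x y : P y -> ideal_add P x y.
Proof. by move=> Py; exists y, 0; rewrite mul0r addr0. Qed.

Lemma ideal_add_self P x : is_ideal P -> ideal_add P x x.
Proof. by case=> P0 _; exists 0, 1; rewrite mul1r add0r. Qed.

(** An ideal maximal among those containing [P] and missing the multiplicative set [S] is prime;
    Zorn's lemma provides one. *)
Lemma exists_prime_avoiding S P :
  S 1 -> (forall x y, S x -> S y -> S (x * y)) ->
  is_ideal P -> (forall x, P x -> ~ S x) ->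
  exists Q, [/\ is_prime_ideal Q, forall x, P x -> Q x & forall x, Q x -> ~ S x].
Proof.
move=> S1 SM iP PS.
pose good (Q : set A) := [/\ is_ideal Q, forall x, P x -> Q x & forall x, Q x -> ~ S x].
have [C Cset0 Cchain|Q [Qgood Qmax]] :=
    @Zorn_bigcup A (fun Q => Q = set0 \/ good Q).
  have [[Q0 CQ0 gQ0]|Nex] := pselect (exists2 Q, C Q & good Q); last first.
    left; apply/seteqP; split => // x [Q CQ Qx].
    by case: (Cset0 _ CQ) => [Q0|gQ]; [rewrite Q0 in Qx | case: Nex; exists Q].
  right; split.
  - split; first by exists Q0 => //; case: gQ0 => -[].
    move=> a x y [X CX Xx] [Y CY Yy].
    have [gX|] := Cset0 _ CX; first by rewrite gX in Xx.
    have [gY|] := Cset0 _ CY; first by rewrite gY in Yy.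
    move=> [iY _ _] [iX _ _].
    have [XY|YX] := Cchain _ _ CX CY.
      by exists Y => //; case: iY => _; apply => //; apply: XY.
    by exists X => //; case: iX => _; apply => //; apply: YX.
  - by move=> x Px; exists Q0 => //; case: gQ0 => _ h _; apply: h.
  - move=> x [X CX Xx]; have [gX|] := Cset0 _ CX; first by rewrite gX in Xx.
    by case=> _ _; apply.
have {Qgood} [Q0|[iQ PQ QS]] := Qgood.
  case: (Qmax P); last by right; split.
  rewrite properEneq Q0; split => //; apply/eqP => P0.
  by case: iP; rewrite -P0.
exists Q; split => //; split => // [Q1|x y Qxy]; first by apply: (QS 1).
have meets z : ~ Q z -> exists p a, Q p /\ S (p + a * z).
  move=> Qz; apply: contrapT => N.
  case: (Qmax (ideal_add Q z)); last first.
    right; split; first exact: ideal_add_ideal.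
      by move=> w Pw; apply/ideal_add_sub/PQ.
    by move=> _ [p [a [Qp ->]]] Sw; apply: N; exists p, a.
  split; first by move=> w; apply: ideal_add_sub.
  by move=> /(_ z) h; apply/Qz/h/ideal_add_self.
apply: contrapT => /not_orP[Qx Qy].
have [p [a [Qp Spx]]] := meets _ Qx; have [q [b [Qq Sqy]]] := meets _ Qy.
apply: (QS _ _ (SM _ _ Spx Sqy)).
have -> : (p + a * x) * (q + b * y) = (q + b * y) * p + (a * x * q + a * b * (x * y)).
  by ring.
by apply: is_idealD; [|apply: is_ideal_mull | apply: is_idealD => //; apply: is_ideal_mull].
Qed.

(* The iterated boundary monoids of Coquand and Lombardi: the Krull dimension
   of [A] is less than [n] iff they contain [0] for every [xs] of size [n]. *)
Fixpoint boundary xs : A -> Prop :=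
  if xs is x :: xs' then
    fun t => exists n a t', boundary xs' t' /\ t = x ^+ n * (t' + a * x)
  else eq 1.

Lemma boundary1 xs : boundary xs 1.
Proof.
elim: xs => //= x xs IH; exists 0%N, 0, 1.
by rewrite mul0r addr0 mulr1.
Qed.

Lemma boundaryM xs t t' : boundary xs t -> boundary xs t' -> boundary xs (t * t').
Proof.
elim: xs t t' => [|x xs IH] t t' /=; first by move=> <- <-; rewrite mulr1.
move=> [n [a [r [Sr ->]]]] [m [b [s [Ss ->]]]].
exists (n + m)%N, (a * s + b * r + a * b * x), (r * s); split; first exact: IH.
by rewrite exprD; ring.
Qed.

(** The chain is built from the bottom. If a prime [Q] containing [P] misses the boundary monoid of
    [x :: xs], then [Q + (x)] misses that of [xs]: an element [p + a * x] of the latter would put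
    [p] in the former. The inclusion is strict since [x] itself lies in the monoid of [x :: xs]. *)
Lemma boundary_chain xs P : is_ideal P -> (forall t, P t -> ~ boundary xs t) ->
  exists2 C, prime_chain (size xs) C & forall t, P t -> C 0%N t.
Proof.
elim: xs P => [|x xs IH] P iP Pxs; have [Q [pQ PQ Qxs]] :=
    exists_prime_avoiding (boundary1 _) (@boundaryM _) iP Pxs.
  by exists (fun=> Q).
have iQ : is_ideal Q by case: pQ.
have [_ [p [a [Qp ->]]] bxs|C [pC sC] QC] := IH _ (ideal_add_ideal x iQ).
  apply: (Qxs _ Qp); exists 0%N, (- a), (p + a * x); split => //.
  by ring.
exists (fun n => if n is n'.+1 then C n' else Q) => //; split; first by case.
case=> [_|n]; last exact: sC.
split; first by move=> y Qy; apply/QC/ideal_add_sub.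
exists x; split; first exact/QC/ideal_add_self.
move=> Qx; apply: (Qxs _ Qx); exists 1%N, 0, 1; split; first exact: boundary1.
by ring.
Qed.

Lemma krull_dim_boundary n xs : has_krull_dim A n -> (n < size xs)%N -> boundary xs 0.
Proof.
move=> [_ An] nxs; apply: contrapT => N.
have [||C pC _] := @boundary_chain xs (eq 0).
- by split => // a x y <- <-; rewrite mulr0 addr0.
- by move=> t <-.
- by have := An _ _ pC; rewrite leqNgt nxs.
Qed.

End PrimeChains.

(* If [y] is a root of a monic [p] of degree [m], then [x^m p(s/x)] is a
   multiple of [s - y x] and lies in [s^m + x B]; this replaces lying over. *)
Lemma boundary_integral (B F : comNzRingType) (phi : {rmorphism B -> F}) (xs : seq B) t :
  (forall y : F, exists2 p : {poly B}, p \is monic & root (map_poly phi p) y) ->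
  boundary (map phi xs) t -> exists2 t', boundary xs t' & exists c, phi t' = c * t.
Proof.
move=> int; elim: xs t => [|x xs IH] t /=.
  by move=> <-; exists 1 => //; exists 1; rewrite rmorph1 mulr1.
move=> [n [a [r [/IH[s bs [c Es]] ->]]]].
(* Here [y = - (c * a)]: since [phi s = c * r], the factor [phi s - y * phi x] is [c] times
   [r + a * phi x]. *)
have [p mp py] := int (- (c * a)).
pose m := (size p).-1.
pose q := \sum_(i < m) p`_i * x ^+ (m.-1 - i) * s ^+ i.
have bsX k : boundary xs (s ^+ k).
  by elim: k => [|k IHk]; rewrite ?expr0 ?exprS; [apply: boundary1 | apply: boundaryM].
exists (x ^+ n * (s ^+ m + q * x)); first by exists n, q, (s ^+ m).
suff [e Ee] : exists e, phi (s ^+ m + q * x) = e * (phi s + c * a * phi x).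
  exists (e * c); rewrite rmorphM Ee rmorphXn Es; ring.
have -> : s ^+ m + q * x = \sum_(i < size p) p`_i * x ^+ (m - i) * s ^+ i.
  have sp : size p = m.+1 by rewrite prednK // lt0n size_poly_eq0 monic_neq0.
  rewrite sp big_ord_recr /= subnn expr0 mulr1 [LHS]addrC; congr (_ + _); last first.
    by rewrite -[LHS]mul1r; congr (_ * _); exact/esym/monicP.
  rewrite mulr_suml; apply: eq_bigr => i _.
  have -> : (m - i)%N = (m.-1 - i).+1 by case: (m) i => [|k] [i lti] //=; rewrite subSn.
  by rewrite exprS; ring.
(* Modulo [phi s - y * phi x], powers of [phi s] become powers of [y * phi x], which turns the sum
   into [phi x ^+ m] times the value of [p] at [y]. *)
have key k : exists e, phi s ^+ k = e * (phi s + c * a * phi x) + (- (c * a) * phi x) ^+ k.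
  elim: k => [|k [e Ek]]; first by exists 0; rewrite mul0r add0r.
  exists (phi s ^+ k + - (c * a) * phi x * e); rewrite !exprS.
  have -> : (- (c * a) * phi x) ^+ k = phi s ^+ k - e * (phi s + c * a * phi x).
    by rewrite Ek; ring.
  by ring.
have [e He] := choice key.
exists (\sum_(i < size p) phi p`_i * phi x ^+ (m - i) * e i).
rewrite rmorph_sum mulr_suml; apply/eqP; rewrite -subr_eq0 -sumrB.
have /eqP := py; rewrite (@horner_coef_wide _ (size p)) ?size_poly //.
move=> /(congr1 (fun z => z * phi x ^+ m)).
rewrite mul0r mulr_suml => /eqP; congr (_ == 0); apply: eq_bigr => i _.
rewrite !rmorphM !rmorphXn {}He coef_map exprMn.
have -> : phi x ^+ m = phi x ^+ (m - i) * phi x ^+ i.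
  by rewrite -exprD subnK // -ltnS (leq_trans (ltn_ord i)) // leqSpred.
by ring.
Qed.

(** Determinant trick: multiplying [(y - M) e = 0] by the adjugate gives [det (y - M) e = 0], and
    one entry of [e] is [1], so the characteristic polynomial vanishes at [y]. *)
Lemma matrix_root_integral (B F : comNzRingType) (phi : {rmorphism B -> F}) q
    (M : 'M[B]_q) (e : 'cV[F]_q) y i0 : e i0 0 = 1 ->
  y *: e = map_mx phi M *m e ->
  exists2 p : {poly B}, p \is monic & root (map_poly phi p) y.
Proof.
move=> e1 ye; exists (char_poly M); first exact: char_poly_monic.
rewrite map_char_poly /root /char_poly -horner_evalE -det_map_mx.
set N := map_mx _ _.
have -> : N = y%:M - map_mx phi M.
  by apply/matrixP => i j; rewrite !mxE /= /horner_eval !hornerE hornerMn hornerX.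
have /(congr1 (mulmx (\adj (y%:M - map_mx phi M)))) : (y%:M - map_mx phi M) *m e = 0.
  by rewrite mulmxBl mul_scalar_mx ye subrr.
rewrite mulmxA mul_adj_mx mulmx0 mul_scalar_mx => /colP /(_ i0).
by rewrite !mxE e1 mulr1 => ->.
Qed.

(** * Multivariate polynomials *)

Lemma mnm_neq0 n (m : 'X_{1..n}) : m != 0%MM -> exists i, m i != 0%N.
Proof.
move=> /eqP m0; apply: contrapT => N; apply: m0.
by apply/mnmP => i; rewrite mnm0E; apply: contrapT => /eqP ?; apply: N; exists i.
Qed.

Section MpolyMorphisms.
Variables (R S : comNzRingType) (n : nat).
Implicit Types (p q : {mpoly R[n]}) (m : 'X_{1..n}).

(** Lets two morphisms out of a polynomial ring be compared on constants and variables only. *)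
Lemma rmorph_mpolyE (f : {rmorphism {mpoly R[n]} -> S}) p :
  f p = mmap (f \o @mpolyC n R) (fun i => f 'X_i) p.
Proof.
rewrite {1}[p]mpolyE rmorph_sum; apply: eq_bigr => m _.
by rewrite -mul_mpolyC rmorphM /= mpolyXE_id rmorph_prod; congr (_ * _);
   apply: eq_bigr => i _; rewrite rmorphXn.
Qed.

Lemma mmap_ideal (f : {rmorphism R -> S}) (P : S -> Prop) (x y : 'I_n -> S) p :
  is_ideal P -> (forall i, P (x i - y i)) -> P (mmap f x p - mmap f y p).
Proof.
move=> iP Pxy; rewrite -sumrB; apply: is_ideal_sum => // m _.
rewrite -mulrBr; apply: is_ideal_mull => //; rewrite /mmap1.
have [P0 _] := iP.
elim/big_rec2: _ => [|i b b' _ IH]; first by rewrite subrr.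
have -> : x i ^+ m i * b' - y i ^+ m i * b = x i ^+ m i * (b' - b) + b * (x i ^+ m i - y i ^+ m i).
  by ring.
apply: is_idealD => //; apply: is_ideal_mull => //.
by rewrite subrXX mulrC; apply: is_ideal_mull.
Qed.

Lemma mmap_dhomog (f : {rmorphism R -> S}) (w : S) (x : 'I_n -> S) p d :
  p \is d.-homog -> mmap f (fun i => w * x i) p = w ^+ d * mmap f x p.
Proof.
move=> /dhomogP hp; rewrite /mmap mulr_sumr big_seq [RHS]big_seq.
apply: eq_bigr => m /hp Em; rewrite mulrCA; congr (_ * _).
have <- : mdeg m = d by []; rewrite mdegE -prodrXr -big_split; apply: eq_bigr => i _; exact: exprMn.
Qed.

Lemma dhomog_sum I (r : seq I) (P : pred I) (F : I -> {mpoly R[n]}) d :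
  (forall i, P i -> F i \is d.-homog) -> \sum_(i <- r | P i) F i \is d.-homog.
Proof. by move=> hF; apply: rpred_sum => i /hF. Qed.

Lemma pihomogM p q d e : q \is e.-homog ->
  pihomog mdeg (d + e) (p * q) = pihomog mdeg d p * q.
Proof.
move=> hq; rewrite {1}(pihomog_partitionE (leqnn (mmeasure mdeg p))) mulr_suml raddf_sum /=.
have hM k : pihomog mdeg k p * q \is (k + e).-homog by apply: dhomogM; first exact: pihomogP.
have E (k : 'I_(mmeasure mdeg p)) : pihomog mdeg (d + e) (pihomog mdeg k p * q) =
    if k == d :> nat then pihomog mdeg d p * q else 0.
  case: eqP => [->|/eqP ne]; first exact: pihomog_dE.
  by apply: pihomog_ne0 (hM k); rewrite eqn_add2r.
rewrite (eq_bigr _ (fun k _ => E k)) -big_mkcond /=.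
have [lt|le] := ltnP d (mmeasure mdeg p).
  by rewrite (big_pred1 (Ordinal lt)) // => k; rewrite -val_eqE.
rewrite big_pred0 => [|k]; last by apply/negbTE; rewrite neq_ltn (leq_trans (ltn_ord k) le).
rewrite pihomogE big_seq_cond big_pred0 ?mul0r // => m.
apply/negP => /andP[/mmeasure_mnm_lt lt /eqP E'].
by have := leq_trans (lt mdeg) le; rewrite E' ltnn.
Qed.

Lemma mdegD_split m d e : mdeg m = (d + e)%N ->
  exists m1 m2, [/\ m = (m1 + m2)%MM, mdeg m1 = d & mdeg m2 = e].
Proof.
elim: d e => [|d IH] e; first by exists 0%MM, m; rewrite add0m mdeg0.
rewrite addSnnS => /IH[m1 [m2 [-> E1 E2]]].
have [i mi] : exists i, m2 i != 0%N by apply: mnm_neq0; rewrite -mdeg_eq0 E2.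
have Em : m2 = (U_(i) + (m2 - U_(i)))%MM by rewrite addmC submK // lep1mP.
exists (m1 + U_(i))%MM, (m2 - U_(i))%MM; rewrite -addmA -Em; split => //.
  by rewrite mdegD mdeg1 E1 addn1.
by apply/eqP; rewrite -(eqn_add2l 1) -(mdeg1 i) -mdegD -Em E2 mdeg1.
Qed.

End MpolyMorphisms.

(** * Specialization of variables over an infinite field *)

Section InfiniteField.
Variables (K : fieldType) (n : nat).
Implicit Types (p t : {mpoly K[n]}) (L : seq 'I_n).

(** Partial specialization that stays in the same ring, so that the variables can be eliminated one
    at a time. *)
Definition mspec L (c : 'I_n -> K) : {mpoly K[n]} -> {mpoly K[n]} :=
  mmap (@mpolyC n K) (fun i => if i \in L then (c i)%:MP else 'X_i).

HB.instance Definition _ L c := GRing.RMorphism.on (mspec L c).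

Lemma mspecX L c i : mspec L c 'X_i = if i \in L then (c i)%:MP else 'X_i.
Proof. by rewrite /mspec mmapX mmap1U. Qed.

Lemma mspec_cons i L c p : mspec (i :: L) c p = mspec [:: i] c (mspec L c p).
Proof.
rewrite [RHS](rmorph_mpolyE (mspec [:: i] c \o mspec L c)) /mspec /mmap.
apply: eq_bigr => m _; congr (_ * _); first by rewrite /= /mspec !mmapC.
apply: mmap1_eq => j /=; rewrite !mspecX in_cons.
have [jL|jL] := boolP (j \in L); first by rewrite orbT /mspec mmapC.
by rewrite orbF mspecX inE.
Qed.

Lemma eq_mspec L c c' p : {in L, c =1 c'} -> mspec L c p = mspec L c' p.
Proof.
move=> cc'; apply: eq_bigr => m _; congr (_ * _); apply: mmap1_eq => i.
by case: ifP => // /cc' ->.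
Qed.

(** Powers of the first variable can be cancelled, and setting it to [0] then removes the term
    [a * x] and leaves a boundary element of the other variables, nonzero by induction. *)
Lemma boundary_vars L t : uniq L -> boundary [seq 'X_i | i <- L] t -> t != 0.
Proof.
move=> uL bt; suff : mspec [::] (fun=> 0) t != 0.
  by apply: contraNneq => ->; rewrite rmorph0.
(* The empty list is generalized to the list [Y] of variables already set to [0], kept disjoint from
   [L]. *)
have : ~~ has (mem L) [::] by [].
elim: L t [::] uL bt => [|x L IH] t Y /=.
  by move=> _ <- _; rewrite rmorph1 oner_neq0.
move=> /andP[xL uL] [k [a [r [br ->]]]] dY.
have xY : x \notin Y by apply: contraNN dY => xY; apply/hasP; exists x => //=; rewrite inE eqxx.
rewrite rmorphM rmorphXn mulf_eq0 negb_or expf_neq0; last first.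
  by rewrite /= mspecX (negbTE xY) -msupp_eq0 msuppX.
have := IH _ (x :: Y) uL br; rewrite /= negb_or xL => /(_ _) h.
apply: contraNneq (h _); last first.
  by apply: contraNN dY; apply: sub_has => z /=; rewrite inE => ->; rewrite orbT.
rewrite mspec_cons; move=> /(congr1 (mspec [:: x] (fun=> 0))).
rewrite rmorph0 rmorphD rmorphM /= mspecX (negbTE xY) rmorphD rmorphM /= mspecX inE eqxx.
by rewrite mpolyC0 mulr0 addr0 => ->.
Qed.

Hypothesis K_infinite : forall s : seq K, exists x, x \notin s.

(** Viewed as a univariate polynomial in ['X_i] over the polynomial ring, [p] has finitely many
    roots, while [K] supplies arbitrarily many distinct constants. *)
Lemma mspec1_neq0 i p : p != 0 -> exists c : K, mspec [:: i] (fun=> c) p != 0.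
Proof.
pose f := mmap (polyC \o @mpolyC n K)
  (fun j => if j == i then 'X else ('X_j)%:P) : _ -> {poly {mpoly K[n]}}.
have f_eval (v : {mpoly K[n]}) : horner_eval v (f p) =
    mmap (@mpolyC n K) (fun j => if j == i then v else 'X_j) p.
  rewrite [LHS](rmorph_mpolyE (horner_eval v \o f)); apply: eq_bigr => m _; congr (_ * _).
    by rewrite /= /f mmapC /= /horner_eval hornerC.
  apply: mmap1_eq => j /=; rewrite /f mmapX mmap1U /horner_eval.
  by case: ifP => _; rewrite ?hornerX ?hornerC.
move=> p0; have fp0 : f p != 0.
  apply: contra_neq p0 => fp0; have := f_eval 'X_i; rewrite fp0 rmorph0 => E.
  rewrite E [LHS](rmorph_mpolyE idfun); apply: eq_bigr => m _; congr (_ * _).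
  by apply: mmap1_eq => j /=; case: eqP => [->|].
apply: contrapT => N.
have all0 c : root (f p) c%:MP.
  apply/eqP; rewrite -horner_evalE f_eval; apply: contrapT => /eqP h; apply: N; exists c.
  move: h; congr (_ != 0); apply: eq_bigr => m _; congr (_ * _).
  by apply: mmap1_eq => j; rewrite inE.
have : exists2 s : seq K, uniq s & size s = size (f p).
  elim: (size _) => [|k [s us <-]]; first by exists [::].
  by have [x xs] := K_infinite s; exists (x :: s); rewrite //= xs.
move=> [s us Es]; have := @max_poly_roots _ (f p) [seq c%:MP | c <- s] fp0.
rewrite size_map Es ltnn => h; suff : false by []; apply: h.
  by apply/allP => _ /mapP[c _ ->].
by rewrite map_inj_uniq // => c c' /eqP; rewrite mpolyC_eq => /eqP.
Qed.

Lemma exists_meval_neq0 p : p != 0 -> exists c : 'I_n -> K, p.@[c] != 0.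
Proof.
move=> p0; have : exists c, mspec (enum 'I_n) c p != 0.
  elim: (enum _) (enum_uniq 'I_n) => [|i L IH] /=.
    exists (fun=> 0); apply: contra_neq p0 => <-.
    by rewrite [LHS](rmorph_mpolyE idfun); apply: eq_bigr.
  move=> /andP[iL /IH[c /(mspec1_neq0 i)[b h]]].
  exists (fun j => if j == i then b else c j); rewrite mspec_cons.
  rewrite (@eq_mspec L _ c) => [|j jL]; last by case: eqP jL iL => // -> ->.
  by rewrite (@eq_mspec _ _ (fun=> b)) // => j; rewrite inE => ->.
move=> [c h]; exists c; apply: contra_neq h => pc0.
suff -> : mspec (enum 'I_n) c p = (p.@[c])%:MP by rewrite pc0 mpolyC0.
apply: etrans (esym (rmorph_mpolyE (@mpolyC n K \o meval c) p)).
apply: eq_bigr => m _; congr (_ * _); first by rewrite /= mevalC.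
by apply: mmap1_eq => i; rewrite mem_enum /= mevalXU.
Qed.

End InfiniteField.

(** * Noether normalization by linear forms *)

Section LinearSpan.
Variables (A : comNzRingType) (s : nat) (v : 'I_s -> A).

Definition span_ideal (x : A) : Prop := exists q : 'I_s -> A, x = \sum_i q i * v i.

Lemma span_ideal_ideal : is_ideal span_ideal.
Proof.
split; first by exists (fun=> 0); rewrite big1 // => i _; rewrite mul0r.
move=> a _ _ [q ->] [r ->]; exists (fun i => a * q i + r i).
by rewrite mulr_sumr -big_split; apply: eq_bigr => i _; rewrite mulrDl mulrA.
Qed.

Lemma span_ideal_mem i : span_ideal (v i).
Proof.
exists (fun j => (j == i)%:R); rewrite (bigD1 i) //= eqxx mul1r big1 ?addr0 // => j.
by move=> /negbTE ->; rewrite mul0r.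
Qed.

End LinearSpan.

Section NoetherNormalization.
Variables (K : fieldType) (u : nat) (F : comNzRingType).
Variables (phi : {rmorphism K -> F}) (g : 'I_u -> F).

Local Notation T := {mpoly K[u]}.
Local Notation ev := (mmap phi g).

(** Together these two hypotheses present [F] as a standard graded [K]-algebra; the grading is
    carried by [{mpoly K[u]}], and the kernel of [ev] is homogeneous. *)
Hypothesis ev_surj : forall x, exists P, x = ev P.
Hypothesis ev_homog : forall P n, ev P = 0 -> ev (pihomog mdeg n P) = 0.

Definition lin_form s (a : 'M[K]_(s, u)) (i : 'I_s) : T := \sum_j a i j *: 'X_j.

Definition lin s (a : 'M[K]_(s, u)) (i : 'I_s) : F := \sum_j phi (a i j) * g j.

(** For positive [n] this makes [F] a finite module over the subalgebra generated by the [lin a i];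
    it is the counterpart in [F] of spanning a reduction. *)
Definition degree_in_span n s (a : 'M[K]_(s, u)) : Prop :=
  forall m : 'X_{1..u}, mdeg m = n -> span_ideal (lin a) (ev 'X_[m]).

Lemma evXU i : ev 'X_i = g i.
Proof. by rewrite mmapX mmap1U. Qed.

Lemma ev_lin_form s (a : 'M[K]_(s, u)) i : ev (lin_form a i) = lin a i.
Proof. by rewrite raddf_sum; apply: eq_bigr => j _; rewrite /= mmapZ evXU. Qed.

Lemma lin_form_homog s (a : 'M[K]_(s, u)) i : lin_form a i \is 1.-homog.
Proof. by apply: dhomog_sum => j _; apply: dhomogZ; rewrite dhomogX /= mdeg1. Qed.

Lemma lin_mulmx s s' (C : 'M[K]_(s', s)) (a : 'M[K]_(s, u)) i :
  lin (C *m a) i = \sum_k phi (C i k) * lin a k.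
Proof.
under eq_bigr do rewrite mulr_sumr; rewrite exchange_big; apply: eq_bigr => j _.
by rewrite mxE rmorph_sum mulr_suml; apply: eq_bigr => k _; rewrite rmorphM mulrA.
Qed.

Lemma lin_homog s (a : 'M[K]_(s, u)) (P : {mpoly K[s]}) n :
  mmap phi (lin a) P = 0 -> mmap phi (lin a) (pihomog mdeg n P) = 0.
Proof.
pose sub := mmap (@mpolyC u K) (lin_form a).
have E (Q : {mpoly K[s]}) : ev (sub Q) = mmap phi (lin a) Q.
  apply: etrans (rmorph_mpolyE (ev \o sub) Q) _; apply: eq_bigr => m _; congr (_ * _).
    by rewrite /= /sub !mmapC.
  by apply: mmap1_eq => i /=; rewrite /sub mmapX mmap1U ev_lin_form.
rewrite -!E => /(ev_homog n); congr (ev _ = 0).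
have sub_sum r (G : 'X_{1..s} -> {mpoly K[s]}) :
    sub (\sum_(m <- r) G m) = \sum_(m <- r) sub (G m) by rewrite /sub raddf_sum.
have -> : pihomog mdeg n P = \sum_(m <- msupp P) pihomog mdeg n (P@_m *: 'X_[m]).
  by rewrite {1}[P]mpolyE raddf_sum.
rewrite {1}[P]mpolyE !sub_sum raddf_sum; apply: eq_bigr => m _.
have E1 (c : K) (Q : {mpoly K[s]}) : sub (c *: Q) = c *: sub Q.
  by rewrite /sub mmapZ mul_mpolyC.
rewrite linearZ /= E1 linearZ /= E1 {E1}; congr (_ *: _).
have hX : sub 'X_[m] \is (mdeg m).-homog.
  rewrite /sub mmapX /mmap1 mdegE.
  elim/big_rec2: _ => [|i d q _ IH]; first exact: dhomog1.
  apply: dhomogM => //; rewrite -[X in X.-homog]mul1n; apply: dhomogMn.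
  exact: lin_form_homog.
rewrite pihomogX; case: eqP => [<-|/eqP ne]; first by rewrite pihomog_dE.
by rewrite /sub mmap0 (pihomog_ne0 ne).
Qed.

Lemma degree_in_spanS n s (a : 'M[K]_(s, u)) :
  degree_in_span n a -> degree_in_span n.+1 a.
Proof.
move=> h m; rewrite -addn1 => /mdegD_split[m1 [m2 [-> /h h1 _]]].
rewrite mpolyXD rmorphM mulrC; apply: is_ideal_mull h1; exact: span_ideal_ideal.
Qed.

(** The coefficients lift to polynomials by surjectivity of [ev], and homogeneity of its kernel
    allows keeping only their components of degree [n]. *)
Lemma degree_in_span_homog n s (a : 'M[K]_(s, u)) m : degree_in_span n.+1 a ->
  mdeg m = n.+1 -> exists2 Q : 'I_s -> T, forall i, Q i \is n.-homog &
    ev 'X_[m] = \sum_i ev (Q i) * lin a i.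
Proof.
move=> h /[dup] dm /h[q Eq]; have [Q0 EQ0] := choice (fun i => ev_surj (q i)).
exists (fun i => pihomog mdeg n (Q0 i)); first by move=> i; apply: pihomogP.
have /(ev_homog n.+1) : ev ('X_[m] - \sum_i Q0 i * lin_form a i) = 0.
  rewrite rmorphB rmorph_sum /= Eq; apply/eqP; rewrite subr_eq0; apply/eqP.
  by apply: eq_bigr => i _; rewrite rmorphM /= ev_lin_form -EQ0.
have -> : pihomog mdeg n.+1 ('X_[m] - \sum_i Q0 i * lin_form a i) =
    'X_[m] - \sum_i pihomog mdeg n (Q0 i) * lin_form a i.
  rewrite pihomogB pihomog_dE; last by rewrite dhomogX /= dm.
  congr (_ - _); rewrite raddf_sum; apply: eq_bigr => i _.
  by rewrite /= -[n.+1]addn1 pihomogM ?lin_form_homog.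
rewrite rmorphB rmorph_sum /= => /eqP; rewrite subr_eq0 => /eqP ->.
by apply: eq_bigr => i _; rewrite rmorphM /= ev_lin_form.
Qed.

(** * Integrality over a subalgebra generated by linear forms *)

Section Integral.
Variables (n s : nat) (a : 'M[K]_(s, u)).
Hypothesis spanned : degree_in_span n.+1 a.

Local Notation B := {mpoly K[s]}.
Local Notation iota := (mmap phi (lin a)).
Local Notation mon := 'X_{1..u < n.+1}.

(** The [B]-submodule of [F] generated by the monomials of degree at most [n]; it turns out to be
    all of [F]. *)
Let gen (x : F) : Prop := exists b : mon -> B, x = \sum_k iota (b k) * ev 'X_[k].

Let genD x y : gen x -> gen y -> gen (x + y).
Proof.
move=> [b ->] [c ->]; exists (fun k => b k + c k); rewrite -big_split.
by apply: eq_bigr => k _; rewrite rmorphD mulrDl.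
Qed.

Let genM (b : B) x : gen x -> gen (iota b * x).
Proof.
move=> [c ->]; exists (fun k => b * c k); rewrite mulr_sumr.
by apply: eq_bigr => k _; rewrite rmorphM mulrA.
Qed.

Let gen_sum I (r : seq I) (P : pred I) (G : I -> F) :
  (forall i, P i -> gen (G i)) -> gen (\sum_(i <- r | P i) G i).
Proof.
move=> h; elim/big_ind: _ => //.
by exists (fun=> 0); rewrite big1 // => i _; rewrite rmorph0 mul0r.
Qed.

(** Induction on the degree: a factor of degree [n.+1] is a sum of terms [Q i] times [lin a i], and
    as [lin a i] is a scalar from [B], the remaining monomials have degree one less. *)
Let genX m : gen (ev 'X_[m]).
Proof.
have [d le] := ubnP (mdeg m); elim: d m le => // d IH m le.
have [lt|ge] := ltnP (mdeg m) n.+1.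
  exists (fun k : mon => (val k == m)%:R); rewrite (bigD1 (BMultinom lt)) //= eqxx.
  rewrite rmorph1 mul1r big1 ?addr0 // => k; rewrite -val_eqE /= => /negbTE ->.
  by rewrite rmorph0 mul0r.
have [m1 [m2 [Em d1 d2]]] := mdegD_split (esym (subnKC ge)).
have [Q hQ EQ] := degree_in_span_homog spanned d1.
rewrite Em mpolyXD rmorphM /= EQ mulr_suml; apply: gen_sum => i _.
have -> : ev (Q i) * lin a i * ev 'X_[m2] = iota 'X_i * ev (Q i * 'X_[m2]).
  by rewrite rmorphM [iota _]mmapX mmap1U /=; ring.
apply: genM; rewrite mulrC {1}[Q i]mpolyE mulr_sumr raddf_sum big_seq; apply: gen_sum => k.
move=> /(dhomogP _ _ _ (hQ i)) dk; rewrite -scalerAr -mpolyXD /= mmapZ.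
have -> c : phi c = iota c%:MP by rewrite mmapC.
have Ek : mdeg k = n by [].
by apply/genM/IH; rewrite mdegD d2 Ek -addnS subnK // -ltnS.
Qed.

(** Multiplication by [y] acts on the finitely many monomial generators through a matrix over [B],
    so the determinant trick applies; the constant monomial gives the entry [1]. *)
Lemma span_integral (y : F) :
  exists2 p : {poly B}, p \is monic & root (map_poly iota p) y.
Proof.
have genT x : gen x.
  have [P ->] := ev_surj x; rewrite [P]mpolyE raddf_sum; apply: gen_sum => m _ /=.
  rewrite mmapZ (_ : phi _ = iota (P@_m)%:MP); [exact/genM/genX | by rewrite mmapC].
have [b Eb] := choice (fun k : mon => genT (y * ev 'X_[k])).
pose M := \matrix_(i < #|{: mon}|, j < #|{: mon}|) b (enum_val i) (enum_val j).
pose e := \col_(i < #|{: mon}|) ev 'X_[enum_val i].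
apply: (@matrix_root_integral _ _ _ _ M e y (enum_rank (@bm0 u n))).
  by rewrite mxE enum_rankK /= mpolyX0 rmorph1.
apply/colP => i; rewrite !mxE Eb (reindex (fun j : 'I_#|{: mon}| => enum_val j)) /=.
  by apply: eq_bigr => k _; rewrite !mxE.
exact/onW_bij/enum_val_bij.
Qed.

End Integral.

Hypothesis K_infinite : forall s : seq K, exists x, x \notin s.
Variable l : nat.
Hypothesis F_dim : has_krull_dim F l.

(** As [s] exceeds the dimension of [F], the boundary monoid of the forms contains [0]. Integrality
    lifts this to a boundary element of the variables, which is nonzero but maps to [0]; a nonzero
    homogeneous component is the relation. *)
Lemma homog_relation n s (a : 'M[K]_(s, u)) : degree_in_span n.+1 a -> (l < s)%N ->
  exists (D : nat) (Q : {mpoly K[s]}),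
    [/\ Q != 0, Q \is D.-homog & mmap phi (lin a) Q = 0].
Proof.
move=> ha ls; pose L := enum 'I_s.
have /boundary_integral : boundary (map (mmap phi (lin a)) [seq 'X_i | i <- L]) 0.
  by apply: krull_dim_boundary F_dim _; rewrite 2!size_map size_enum_ord.
case=> [y|t bt [c]]; first exact: span_integral ha y.
rewrite mulr0 => t0; have {bt} tn0 := boundary_vars (enum_uniq _) bt.
have [D hD] : exists D, pihomog mdeg D t != 0.
  apply: contrapT => N; move/eqP: tn0; apply.
  rewrite (pihomog_partitionE (leqnn (mmeasure mdeg t))) big1 // => D _.
  by apply: contrapT => /eqP ?; apply: N; exists D.
by exists D, (pihomog mdeg D t); split; [| apply: pihomogP | apply: lin_homog].
Qed.

Lemma homog_relation_point n s (a : 'M[K]_(s, u)) : degree_in_span n.+1 a -> (l < s)%N ->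
  exists (D : nat) (Q : {mpoly K[s]}) (c : 'I_s -> K) (p : 'I_s),
    [/\ Q \is D.-homog, mmap phi (lin a) Q = 0, Q.@[c] != 0 & c p != 0].
Proof.
move=> ha ls; have [D [Q [Qn0 hQ EQ]]] := homog_relation ha ls.
have [c Qc] := exists_meval_neq0 K_infinite Qn0.
have [[p cp]|N] := pselect (exists p, c p != 0); first by exists D, Q, c, p.
have c0 i : c i = 0 by apply: contrapT => /eqP ?; apply: N; exists i.
(* At [c = 0], scaling by [0] equates the value of [Q] with [0 ^+ D] times its value at the forms,
   which vanishes even when [D = 0] because [Q] is a relation. *)
have E0 (f : {rmorphism K -> F}) : f Q.@[c] = 0 ^+ D * mmap f (lin a) Q.
  rewrite -(mmap_dhomog _ 0 _ hQ) [LHS](rmorph_mpolyE (f \o meval c)).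
  apply: eq_bigr => m _; congr (_ * _); first by rewrite /= mevalC.
  by apply: mmap1_eq => i; rewrite /= mevalXU c0 rmorph0 mul0r.
by have /eqP := E0 phi; rewrite EQ mulr0 fmorph_eq0 (negbTE Qc).
Qed.

(** Modulo the new forms each [lin a k] becomes [phi (c k) * w], where [w] is [lin a p] divided by
    [c p]. The relation then reads [Q.@[c] * w ^+ D = 0], so [w] is nilpotent modulo them. *)
Lemma noether_step n s (a : 'M[K]_(s.+1, u)) : degree_in_span n a -> (l < s.+1)%N ->
  exists (C : 'M[K]_(s, s.+1)) (n' : nat), degree_in_span n' (C *m a).
Proof.
move=> /degree_in_spanS ha ls.
have [D [Q [c [p [hQ EQ Qc cp]]]]] := homog_relation_point ha ls.
(* The rows of [C] are the linear forms [x_i - (c_i / c_p) x_p], for [i] other than [p], which cut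
   out the line through [c]. *)
pose C : 'M[K]_(s, s.+1) :=
  \matrix_(i, k) ((k == lift p i)%:R - c (lift p i) / c p * (k == p)%:R).
(* Each block of degree [n.+1] contributes one factor [w] modulo the new forms, so [D] blocks give a
   multiple of [w ^+ D]. *)
exists C, (n.+1 * D)%N.
pose P := span_ideal (lin (C *m a)); have iP : is_ideal P by apply: span_ideal_ideal.
pose w := phi (c p)^-1 * lin a p.
have linC i : lin (C *m a) i = lin a (lift p i) - phi (c (lift p i)) * w.
  rewrite lin_mulmx; under eq_bigr do rewrite mxE rmorphB mulrBl.
  rewrite sumrB (bigD1 (lift p i)) //= eqxx rmorph1 mul1r big1 ?addr0 => [|k /negbTE ->]; last first.
    by rewrite rmorph0 mul0r.
  rewrite (bigD1 p) //= eqxx mulr1 rmorphM big1 ?addr0 => [|k /negbTE ->]; last first.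
    by rewrite mulr0 rmorph0 mul0r.
  by rewrite mulrA.
have Pw k : P (lin a k - w * phi (c k)).
  case: (unliftP p k) => [i|] ->; first by rewrite mulrC -linC; apply: span_ideal_mem.
  by rewrite /w mulrAC -rmorphM mulVf // rmorph1 mul1r subrr; case: iP.
have PwD : P (w ^+ D).
  have := mmap_ideal phi Q iP Pw; rewrite EQ sub0r => /(is_idealN iP); rewrite opprK.
  rewrite (mmap_dhomog _ w _ hQ).
  have -> : mmap phi (fun i => phi (c i)) Q = phi Q.@[c].
    rewrite [RHS](rmorph_mpolyE (phi \o meval c)); apply: eq_bigr => m _.
    by congr (_ * _); [rewrite /= mevalC | apply: mmap1_eq => i; rewrite /= mevalXU].
  move=> /(is_ideal_mull (phi Q.@[c]^-1) iP).
  by rewrite mulrCA -rmorphM mulVf // rmorph1 mulr1.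
suff key k m : mdeg m = (n.+1 * k)%N -> exists b, P (ev 'X_[m] - b * w ^+ k).
  move=> m /key[b Pb]; rewrite -[ev _](subrK (b * w ^+ D)).
  by apply: is_idealD => //; apply: is_ideal_mull.
elim: k m => [|k IH] m.
  by move=> _; exists (ev 'X_[m]); rewrite mulr1 subrr; case: iP.
rewrite mulnS => /mdegD_split[m1 [m2 [-> d1 /IH[b Pb]]]].
have [q Eq] := ha _ d1; exists (b * \sum_i q i * phi (c i)).
have Pm1 : P (ev 'X_[m1] - (\sum_i q i * phi (c i)) * w).
  rewrite Eq mulr_suml -sumrB; apply: is_ideal_sum => // i _.
  by rewrite -mulrA -mulrBr; apply: is_ideal_mull; rewrite // mulrC.
rewrite mpolyXD rmorphM /= exprS.
set z := \sum_i _ in Pm1 *.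
have -> : ev 'X_[m1] * ev 'X_[m2] - b * z * (w * w ^+ k) =
  ev 'X_[m2] * (ev 'X_[m1] - z * w) + z * w * (ev 'X_[m2] - b * w ^+ k) by ring.
by apply: is_idealD => //; apply: is_ideal_mull.
Qed.

(** Rows are removed one at a time while more than [l] remain; a shorter family is padded with zero
    rows. *)
Lemma noether_normalization n s (a : 'M[K]_(s, u)) : degree_in_span n a ->
  exists (C : 'M[K]_(l, s)) (n' : nat), degree_in_span n'.+1 (C *m a).
Proof.
elim: s a n => [|s IH] a n ha; last have [ls|sl] := ltnP l s.+1.
- exists 0, n => m /(degree_in_spanS ha)[q ->].
  by rewrite big_ord0; have [] := span_ideal_ideal (lin ((0 : 'M[K]_(l, 0)) *m a)).
- have [C [n1 /IH[C' [n2 h]]]] := noether_step ha ls.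
  by exists (C' *m C), n2; rewrite -mulmxA.
exists (\matrix_(i, k) (val i == val k)%:R), n => m /(degree_in_spanS ha)[q ->].
set a' := _ *m a; have iP := span_ideal_ideal (lin a').
apply: is_ideal_sum => // k _; apply: is_ideal_mull => //.
have -> : lin a k = lin a' (widen_ord sl k); last exact: span_ideal_mem.
rewrite lin_mulmx (bigD1 k) //= mxE eqxx rmorph1 mul1r big1 ?addr0 // => j jk.
by rewrite mxE /= eq_sym val_eqE (negbTE jk) rmorph0 mul0r.
Qed.

End NoetherNormalization.

(** * The special fiber ring *)

Section FiberScalar.
Variables (K : fieldType) (d : nat) (I : {mpoly K[d]} -> Prop).

Definition rees_monom n c (Ic : ideal_pow I n c) : rees I := Rees (rees_monom_subproof Ic).

Definition rees_scalar (c : K) : rees I := @rees_monom 0 c%:MP_[d] Logic.I.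

Lemma rees_scalar_is_zmod_morphism : zmod_morphism rees_scalar.
Proof.
move=> x y; apply: val_inj => /=.
by rewrite -scalerBl -mpolyCB.
Qed.

Lemma rees_scalar_is_monoid_morphism : monoid_morphism rees_scalar.
Proof.
split; first by apply: val_inj; rewrite /= mpolyC1 scale1r expr0.
move=> x y; apply: val_inj => /=.
by rewrite -scalerAl -scalerAr scalerA mulr1 mpolyCM.
Qed.

HB.instance Definition _ :=
  GRing.isZmodMorphism.Build K (rees I) rees_scalar rees_scalar_is_zmod_morphism.
HB.instance Definition _ :=
  GRing.isMonoidMorphism.Build K (rees I) rees_scalar rees_scalar_is_monoid_morphism.

Definition fiber_pi : rees I -> fiber I := \pi_({ideal_quot (@fiber_ker K d I)}).
HB.instance Definition _ := GRing.RMorphism.on fiber_pi.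

Lemma fiber_scalar_is_zmod_morphism : zmod_morphism (@fiber_scalar K d I).
Proof. by move=> x y; rewrite -[RHS](rmorphB (fiber_pi \o rees_scalar)). Qed.

Lemma fiber_scalar_is_monoid_morphism : monoid_morphism (@fiber_scalar K d I).
Proof.
split; first exact: (rmorph1 (fiber_pi \o rees_scalar)).
by move=> x y; rewrite -[RHS](rmorphM (fiber_pi \o rees_scalar)).
Qed.

HB.instance Definition _ :=
  GRing.isZmodMorphism.Build K (fiber I) (@fiber_scalar K d I) fiber_scalar_is_zmod_morphism.
HB.instance Definition _ :=
  GRing.isMonoidMorphism.Build K (fiber I) (@fiber_scalar K d I) fiber_scalar_is_monoid_morphism.

Lemma fiber_pi_eq0 p : fiber_pi p = 0 <->
  forall n, ideal_mul (max_ideal K d) (ideal_pow I n) (rees_val p)`_n.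
Proof.
rewrite -[0](rmorph0 fiber_pi); split.
  by move=> /eqP; rewrite -Quotient.idealrBE subr0 => /fiber_kerP.
by move=> h; apply/eqP; rewrite -Quotient.idealrBE subr0; apply/fiber_kerP.
Qed.

Lemma fiber_pi_surj x : exists p, x = fiber_pi p.
Proof. by exists (repr x); rewrite /fiber_pi reprK. Qed.

End FiberScalar.

(** * Order of vanishing at the origin *)

Section OrderIdeal.
Variables (K : fieldType) (d : nat).
Implicit Types (p q : {mpoly K[d]}).

Definition order_ge (k : nat) p : Prop := forall m : 'X_{1..d}, (mdeg m < k)%N -> p@_m = 0.

Lemma order_geM k l p q : order_ge k p -> order_ge l q -> order_ge (k + l) (p * q).
Proof.
move=> kp lq m lt; rewrite mcoeffM big1 // => -[m1 m2] /= /eqP Em.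
have [lt1|le1] := ltnP (mdeg m1) k; first by rewrite kp // mul0r.
rewrite lq ?mulr0 // ltnNge; apply/negP => le2.
by move: lt; rewrite Em mdegD ltnNge leq_add.
Qed.

Lemma order_ge_ideal k : is_ideal (order_ge k).
Proof.
split; first by move=> m _; rewrite mcoeff0.
move=> a p q kp kq m lt; rewrite mcoeffD kq // addr0.
by apply: (order_geM (k := 0) (l := k) _ kp lt) => m'; rewrite ltn0.
Qed.

Lemma order_geX m : order_ge (mdeg m) 'X_[m].
Proof. by move=> m' lt; rewrite mcoeffX; case: eqP lt => // ->; rewrite ltnn. Qed.

Lemma order_ge_pihomog k p : order_ge k.+1 p -> pihomog mdeg k p = 0.
Proof.
move=> kp; rewrite pihomogE big1 // => m /eqP dm.
by rewrite kp ?scale0r // ltnS -dm.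
Qed.

End OrderIdeal.

(** * Presentation of the special fiber ring by forms in [u] variables *)

Section FiberEval.
Variables (K : fieldType) (d u : nat) (f : 'I_u -> 'X_{1..d}).

Local Notation R := {mpoly K[d]}.
Local Notation T := {mpoly K[u]}.
Local Notation I := (mono_ideal K f).
Local Notation mm := (max_ideal K d).
Local Notation ev := (mmap (@fiber_scalar K d I) (@fiber_gen K d u f)).

(** Lifts [ev] to [R]: a form of degree [n] is sent to a representative in [I^n] of its class in
    [I^n / m I^n]. *)
Definition ev_mono : T -> R := mmap (@mpolyC d K) (fun j => 'X_[f j]).
HB.instance Definition _ := GRing.RMorphism.on ev_mono.

Lemma ev_monoZ c P : ev_mono (c *: P) = c *: ev_mono P.
Proof. by rewrite /ev_mono mmapZ mul_mpolyC. Qed.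

Lemma ev_monoXU j : ev_mono 'X_j = 'X_[f j].
Proof. by rewrite /ev_mono mmapX mmap1U. Qed.

Lemma ev_mono_pow n P : P \is n.-homog -> ideal_pow I n (ev_mono P).
Proof.
move=> /dhomogP hP; rewrite [P]mpolyE rmorph_sum big_seq.
apply: is_ideal_sum; first exact: ideal_pow_ideal.
move=> m /hP Em; rewrite /= ev_monoZ -mul_mpolyC; apply: is_ideal_mull.
  exact: ideal_pow_ideal.
have <- : mdeg m = n by [].
rewrite /ev_mono mmapX /mmap1 mdegE {Em}.
elim/big_rec2: _ => [|i k x _ IH] //; apply: ideal_powD => //.
elim: (m i) => [|j IHj] //; rewrite exprS; apply: mem_ideal_mul => //.
exact: mono_ideal_gen.
Qed.

(** [ev] is lifted to the Rees algebra inside [R[t]], the [j]-th variable going to [f_j t], so that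
    the coefficient of [t^n] sees only the component of degree [n]. *)
Lemma evE P : exists2 p : rees I, ev P = fiber_pi p &
  forall n, (rees_val p)`_n = ev_mono (pihomog mdeg n P).
Proof.
pose gR j := rees_monom (ideal_pow1 (mono_ideal_gen K f j)).
pose rho := mmap (@rees_scalar K d I) gR.
exists (rho P).
  apply/esym/(etrans (rmorph_mpolyE (@fiber_pi K d I \o rho) P)).
  apply: eq_bigr => m _; congr (_ * _); first by rewrite /= /rho mmapC.
  by apply: mmap1_eq => j; rewrite /= /rho mmapX mmap1U.
move=> n; pose tau := mmap (polyC \o @mpolyC d K) (fun j => 'X_[f j] *: 'X) : T -> {poly R}.
have -> : rees_val (rho P) = tau P.
  apply: (etrans (rmorph_mpolyE ((val : rees I -> {poly R}) \o rho) P)).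
  apply: eq_bigr => m _; congr (_ * _).
    by rewrite /= /rho mmapC /= expr0 alg_polyC.
  by apply: mmap1_eq => j; rewrite /= /rho mmapX mmap1U.
rewrite pihomogE [ev_mono _]rmorph_sum /tau /mmap coef_sum [RHS]big_mkcond; apply: eq_bigr => m _.
rewrite /= coefCM; have -> : mmap1 (fun j => 'X_[f j] *: 'X) m =
    ev_mono 'X_[m] *: 'X^(mdeg m) :> {poly R}.
  rewrite /ev_mono mmapX /mmap1 mdegE -prodrXr -scaler_prod.
  by apply: eq_bigr => j _; rewrite exprZn.
rewrite coefZ coefXn eq_sym; case: eqP => _; rewrite ?mulr0 // mulr1.
by rewrite ev_monoZ mul_mpolyC.
Qed.

Lemma ev_eq0 P : ev P = 0 <->
  forall n, ideal_mul mm (ideal_pow I n) (ev_mono (pihomog mdeg n P)).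
Proof.
have [p -> Ep] := evE P; apply: (iff_trans (fiber_pi_eq0 p)).
by split=> h n; [rewrite -Ep | rewrite Ep].
Qed.

Lemma pihomog_pihomog k n (P : T) :
  pihomog mdeg k (pihomog mdeg n P) = if k == n then pihomog mdeg n P else 0.
Proof.
case: eqP => [->|/eqP ne]; first by rewrite pihomog_id.
by apply: pihomog_ne0 (pihomogP _ _ _); rewrite eq_sym.
Qed.

Lemma ev_homog P n : ev P = 0 -> ev (pihomog mdeg n P) = 0.
Proof.
move=> /ev_eq0 h; apply/ev_eq0 => k; rewrite pihomog_pihomog; case: eqP => [->|_] //.
by rewrite rmorph0; case: (ideal_mul_ideal mm (ideal_pow I k)).
Qed.

Lemma ev_dhomog_eq0 n P : P \is n.-homog ->
  ideal_mul mm (ideal_pow I n) (ev_mono P) -> ev P = 0.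
Proof.
move=> hP h; apply/ev_eq0 => k; rewrite -(pihomog_dE hP) pihomog_pihomog.
case: eqP => [->|_]; first by rewrite pihomog_dE.
by rewrite rmorph0; case: (ideal_mul_ideal mm (ideal_pow I k)).
Qed.

Lemma max_ideal_sub_const p : mm (p - (p@_0%MM)%:MP).
Proof.
have imm : is_ideal mm by apply: ideal_gen_ideal.
suff key (m : 'X_{1..d}) : m != 0%MM -> mm 'X_[m].
  rewrite {1}[p]mpolyE.
  have E0 : (p@_0%MM)%:MP = \sum_(m <- msupp p | m == 0%MM) p@_m *: 'X_[m].
    have [in0|nin0] := boolP (0%MM \in msupp p).
      rewrite (big_rem _ in0) /= eqxx big_seq_cond big_pred0 ?addr0; last first.
        move=> m; apply/negP => /andP[+ /eqP E]; rewrite E mem_rem_uniq ?msupp_uniq //.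
        by rewrite inE eqxx.
      by rewrite mpolyX0 -mul_mpolyC mulr1.
    rewrite memN_msupp_eq0 // mpolyC0 big_seq_cond big_pred0 // => m.
    by apply/negP => /andP[+ /eqP E]; rewrite E (negbTE nin0).
  rewrite E0 (bigID (fun m => m == 0%MM)) /= [X in X - _]addrC addrK.
  by apply: is_ideal_sum => // m /key h; rewrite -mul_mpolyC; apply: is_ideal_mull.
move=> /mnm_neq0[i mi].
rewrite -(@submK _ U_(i)%MM m) ?lep1mP // mpolyXD; apply: is_ideal_mull => //.
by apply: mem_ideal_gen; exists i.
Qed.

Lemma ideal_mul_eq0 n : ideal_mul mm (ideal_pow I n) 0.
Proof. by case: (ideal_mul_ideal mm (ideal_pow I n)). Qed.

(** Modulo [m I^n], coefficients in [R] may be replaced by their constant terms, so products of [n]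
    generators span over [K]. *)
Lemma ideal_pow_ev_mono n c : ideal_pow I n c ->
  exists2 Q, Q \is n.-homog & ideal_mul mm (ideal_pow I n) (c - ev_mono Q).
Proof.
elim: n c => [|n IH] c Ic.
  exists (c@_0%MM)%:MP; first by rewrite -alg_mpolyC; apply: dhomogZ; exact: dhomog1.
  rewrite /ev_mono mmapC -[X in ideal_mul _ _ X]mulr1; apply: mem_ideal_mul => //.
  exact: max_ideal_sub_const.
have imul := ideal_mul_ideal mm (ideal_pow I n.+1).
have ipow := ideal_pow_ideal I n.+1.
pose D x := exists2 Q, Q \is n.+1.-homog & ideal_mul mm (ideal_pow I n.+1) (x - ev_mono Q).
have DD x y : D x -> D y -> D (x + y).
  move=> [Q hQ Qx] [S hS Sy]; exists (Q + S); first exact: dhomogD.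
  by rewrite rmorphD opprD addrACA; apply: is_idealD.
have Dsum k (G : 'I_k -> R) : (forall i, D (G i)) -> D (\sum_i G i).
  move=> DG; elim/big_ind: _ => // [].
  by exists 0; rewrite ?dhomog0 // rmorph0 subrr; apply: ideal_mul_eq0.
have DM a x : ideal_pow I n.+1 x -> D x -> D (a * x).
  move=> Ix [Q hQ Qx]; exists (a@_0%MM *: Q); first exact: dhomogZ.
  have -> : a * x - ev_mono (a@_0%MM *: Q) =
      (a - (a@_0%MM)%:MP) * x + (a@_0%MM)%:MP * (x - ev_mono Q).
    by rewrite ev_monoZ -mul_mpolyC; ring.
  apply: is_idealD => //; last exact: is_ideal_mull.
  by apply: mem_ideal_mul => //; apply: max_ideal_sub_const.
move: Ic => [k [a [h [hg ->]]]]; apply: (Dsum) => i.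
have [p [q [Ip Iq Eh]]] := hg i.
apply: (DM); first by rewrite Eh; apply: mem_ideal_mul.
rewrite Eh; have [k' [b [x [xg ->]]]] := Ip; rewrite mulr_suml; apply: Dsum => j.
have [j' Ex] := xg j; rewrite -mulrA; apply: DM.
  by apply: mem_ideal_mul => //; rewrite Ex; apply: mono_ideal_gen.
have [Q hQ Qq] := IH _ Iq; exists ('X_j' * Q).
  by rewrite -[n.+1]add1n; apply: dhomogM => //; rewrite dhomogX /= mdeg1.
rewrite rmorphM /= ev_monoXU Ex -mulrBr.
by apply: (@ideal_mul_pow _ I 1 n) => //; apply/ideal_pow1/mono_ideal_gen.
Qed.

Lemma fiber_classE n c (Ic : ideal_pow I n c) :
  exists2 Q, Q \is n.-homog & fiber_class Ic = ev Q.
Proof.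
have [Q hQ Qc] := ideal_pow_ev_mono Ic; exists Q => //.
have [p -> Ep] := evE Q; apply/eqP; rewrite -subr_eq0; apply/eqP.
rewrite -[fiber_class Ic]/(fiber_pi (rees_monom Ic)) -rmorphB; apply/fiber_pi_eq0 => k.
have -> : rees_val (rees_monom Ic - p) = c *: 'X^n - rees_val p by [].
rewrite coefB Ep coefZ coefXn -(pihomog_dE hQ) pihomog_pihomog.
case: eqP => [->|_]; first by rewrite mulr1 pihomog_dE.
by rewrite mulr0 rmorph0 subrr; apply: ideal_mul_eq0.
Qed.

(** An element of the Rees algebra is the finite sum of its graded components, and the class of each
    is represented by a form. *)
Lemma ev_surj x : exists P, x = ev P.
Proof.
have [p ->] := fiber_pi_surj x.
have Ip n : ideal_pow I n (rees_val p)`_n by exact: (elimT (rees_predP _ _) (rees_valP p)).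
have -> : p = \sum_(i < size (rees_val p)) rees_monom (Ip i).
  apply: val_inj; rewrite [val (\sum_(i < _) _)]rmorph_sum /=.
  by rewrite -[LHS]coefK poly_def.
have /choice[Q EQ] n : exists Q, fiber_class (Ip n) = ev Q.
  by have [Q _ ->] := fiber_classE (Ip n); exists Q.
exists (\sum_(i < size (rees_val p)) Q i); rewrite !rmorph_sum; apply: eq_bigr => i _.
exact: EQ.
Qed.

End FiberEval.

(** * Elimination *)

Lemma det_mul_ideal (A : comNzRingType) (P : A -> Prop) q (M : 'M[A]_q) (e : 'I_q -> A) i :
  is_ideal P -> (forall k, P (\sum_j M k j * e j)) -> P (\det M * e i).
Proof.
move=> iP PM; pose E := \col_j e j.
have -> : \det M * e i = (\adj M *m (M *m E)) i 0.
  by rewrite mulmxA mul_adj_mx mul_scalar_mx !mxE.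
rewrite mxE; apply: is_ideal_sum => // k _; apply: is_ideal_mull => //.
by rewrite mxE; under eq_bigr do rewrite mxE.
Qed.

Section Elimination.
Variables (K : fieldType) (d u l : nat) (f : 'I_u -> 'X_{1..d}).

Local Notation T := {mpoly K[u]}.
Local Notation I := (mono_ideal K f).
Local Notation F := (fiber I).
Local Notation phi := (@fiber_scalar K d I).
Local Notation g := (@fiber_gen K d u f).
Local Notation ev := (mmap phi g).
Local Notation kz := (@kz_to_Fz K d u l f).
Local Notation H := (@H_ideal K d u l f).

HB.instance Definition _ := GRing.RMorphism.on kz.

Lemma fiber_plus_sub x : fiber_plus x -> span_ideal g x.
Proof.
apply: ideal_gen_sub; first exact: span_ideal_ideal.
move=> _ [n [c [Ic [n0 ->]]]]; have [Q /dhomogP hQ ->] := fiber_classE Ic.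
have isp := span_ideal_ideal g.
rewrite [Q]mpolyE raddf_sum big_seq; apply: is_ideal_sum => // m /hQ dm /=.
rewrite mmapZ; apply: is_ideal_mull => //.
have [m1 [m2 [-> d1 d2]]] : exists m1 m2, [/\ m = (m1 + m2)%MM, mdeg m1 = 1%N & mdeg m2 = n.-1].
  by apply: mdegD_split; rewrite add1n prednK.
have /mdeg1P[j /eqP ->] : mdeg m1 == 1%N by rewrite d1.
by rewrite mpolyXD rmorphM /= evXU mulrC; apply: is_ideal_mull => //; apply: span_ideal_mem.
Qed.

(** Reduces the saturation condition in [A_ideal] to a check on the classes of monomials of degree
    [n]. *)
Lemma fiber_plus_ext_pow n y : ideal_pow (@fiber_plus_ext K d u l f) n y ->
  ideal_gen (fun x => exists2 m, mdeg m = n & x = (ev 'X_[m])%:MP) y.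
Proof.
elim: n y => [|n IH] y.
  move=> _; rewrite -[y]mulr1; apply: is_ideal_mull; first exact: ideal_gen_ideal.
  by apply: mem_ideal_gen; exists 0%MM; rewrite ?mdeg0 // mpolyX0 rmorph1 mpolyC1.
set G := ideal_gen _; have iG : is_ideal G by apply: ideal_gen_ideal.
apply: ideal_gen_sub => // _ [p [q [Pp /IH Pq ->]]].
pose P1 (z : {mpoly F[l * u]}) := forall q,
  ideal_gen (fun x => exists2 m, mdeg m = n & x = (ev 'X_[m])%:MP) q -> G (z * q).
have iP1 : is_ideal P1.
  split; first by move=> z _; rewrite mul0r; case: iG.
  move=> a x x' h h' z hz; rewrite mulrDl -mulrA; apply: is_idealD => //; last exact: h'.
  by apply: is_ideal_mull => //; apply: h.
suff : P1 p by apply.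
apply: (ideal_gen_sub iP1) Pp => _ [c /fiber_plus_sub[b ->] ->].
rewrite rmorph_sum; apply: is_ideal_sum => // j _; rewrite rmorphM.
apply: (is_ideal_mull _ iP1) => z; apply: (ideal_gen_sub (P := fun z => G ((g j)%:MP * z))).
  split; first by rewrite mulr0; case: iG.
  by move=> a x x' h h'; rewrite mulrDr mulrCA; case: iG => _; apply.
move=> _ [m dm ->]; apply: mem_ideal_gen; exists (U_(j) + m)%MM.
  by rewrite mdegD mdeg1 dm.
by rewrite mpolyXD rmorphM /= evXU mpolyCM.
Qed.

Definition matrix_point (a : 'M[K]_(l, u)) (k : 'I_(l * u)) : K := mxvec a 0 k.

Section DegreeCover.
Variables (n : nat) (a : 'M[K]_(l, u)).
Hypothesis spanned : degree_in_span phi g n.+1 a.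

Local Notation mon := 'X_{1..u < n.+2}.

(** The index type [mon] includes lower degrees; the value [0] there makes sums over [mon] see only
    degree [n.+1]. *)
Let e (m : 'X_{1..u}) : F := if mdeg m == n.+1 then ev 'X_[m] else 0.

Let ev_expand (P : T) : P \is n.+1.-homog -> ev P = \sum_(k : mon) phi P@_k * e k.
Proof.
move=> /dhomogP hP.
have lt : (msize P <= n.+2)%N.
  by rewrite msizeE; apply/bigmax_leqP_seq => m /hP -> _.
rewrite [in LHS](mpolywE lt) raddf_sum /=; apply: eq_bigr => k _.
rewrite mmapZ /e; case: eqP => // /eqP ne; rewrite memN_msupp_eq0 ?rmorph0 ?mul0r //.
by apply: contra ne => /hP ->.
Qed.

Let cover : exists Q : mon -> 'I_l -> T, forall k : mon,
  (forall i, Q k i \is n.-homog) /\ e k = \sum_i ev (Q k i) * lin phi g a i.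
Proof.
suff h (k : mon) : exists Q : 'I_l -> T,
    (forall i, Q i \is n.-homog) /\ e k = \sum_i ev (Q i) * lin phi g a i.
  by have [Q hQ] := choice h; exists Q.
rewrite /e; case: eqP => [dk|_].
  have [Q hQ EQ] := degree_in_span_homog (@ev_surj K d u f) (@ev_homog K d u f) spanned dk.
  by exists Q.
exists (fun=> 0); split => [i|]; first exact: dhomog0.
by rewrite big1 // => i _; rewrite rmorph0 mul0r.
Qed.

(* Nakayama's lemma over the point [a]: the determinant kills the degree [n.+1]
   part of [F[z] / H] and equals [1] at [a]. *)
Lemma elimination_nonvanishing : exists2 c, A_ideal K l f c & c.@[matrix_point a] != 0.
Proof.
have [Q hQ] := cover.
(* Row [k] of [M] expands the sum over [i] of the [i]-th generic form times [Q k i] in monomials, so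
   [M e] lies in [H]. By the choice of [Q], the value of [M] at [a] fixes [e]; hence [N e = M e],
   while [N] specializes to the identity. *)
pose coefs (k k' : mon) i j : K := ('X_j * Q k i)@_k'.
pose M k k' : {mpoly K[l * u]} := \sum_i \sum_j zvar K i j * (coefs k k' i j)%:MP.
pose N k k' : {mpoly K[l * u]} := M k k' - ((M k k').@[matrix_point a])%:MP + (k == k')%:R%:MP.
pose NN := \matrix_(i < #|{: mon}|, j < #|{: mon}|) N (enum_val i) (enum_val j).
have iH : is_ideal H by apply: ideal_gen_ideal.
(* The coefficients [zeta] are left free, to be taken once as the variables [z_ij] and once as the
   entries of [a]. *)
have gen_sum (zeta : 'I_l -> 'I_u -> {mpoly F[l * u]}) k :
    \sum_k' (\sum_i \sum_j zeta i j * (phi (coefs k k' i j))%:MP) * (e k')%:MP =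
    \sum_i (\sum_j (g j)%:MP * zeta i j) * (ev (Q k i))%:MP.
  under eq_bigr do rewrite mulr_suml; rewrite exchange_big; apply: eq_bigr => i _.
  under eq_bigr do rewrite mulr_suml; rewrite exchange_big mulr_suml; apply: eq_bigr => j _.
  have hX : 'X_j * Q k i \is n.+1.-homog.
    by rewrite -[n.+1]add1n; apply: dhomogM; [rewrite dhomogX /= mdeg1 | case: (hQ k)].
  rewrite -mulrA mulrCA -mpolyCM -(evXU phi g) -[ev 'X_j * _](rmorphM ev) /=.
  rewrite (ev_expand hX) rmorph_sum mulr_sumr.
  by apply: eq_bigr => k' _; rewrite /= mpolyCM mulrA.
have HN k : H (\sum_k' kz (N k k') * (e k')%:MP).
  have HM : H (\sum_k' kz (M k k') * (e k')%:MP).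
    have -> : \sum_k' kz (M k k') * (e k')%:MP =
        \sum_i (ev (Q k i))%:MP * @H_gen K d u l f i.
      under [RHS]eq_bigr do rewrite mulrC.
      rewrite -(gen_sum (fun i j => 'X_(mxvec_index i j))); apply: eq_bigr => k' _.
      congr (_ * _); rewrite rmorph_sum; apply: eq_bigr => i _.
      rewrite rmorph_sum; apply: eq_bigr => j _.
      by rewrite rmorphM /= /zvar /kz_to_Fz map_mpolyX map_mpolyC.
    apply: is_ideal_sum => // i _; apply: is_ideal_mull => //.
    by apply: mem_ideal_gen; exists i.
  have Ma k' : (M k k').@[matrix_point a] = \sum_i \sum_j a i j * coefs k k' i j.
    rewrite rmorph_sum; apply: eq_bigr => i _; rewrite rmorph_sum; apply: eq_bigr => j _.
    by rewrite /= mevalM mevalC mevalXU /matrix_point mxvecE.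
  have Ea : \sum_k' kz ((M k k').@[matrix_point a])%:MP * (e k')%:MP = (e k)%:MP.
    have [_ ->] := hQ k.
    transitivity (\sum_i (\sum_j (g j)%:MP_[l * u] * (phi (a i j))%:MP_[l * u]) *
      (ev (Q k i))%:MP_[l * u]).
      rewrite -(gen_sum (fun i j => (phi (a i j))%:MP)); apply: eq_bigr => k' _.
      congr (_ * _); rewrite Ma /kz_to_Fz map_mpolyC.
      pose cphi := @mpolyC (l * u) F \o phi.
      apply: (etrans (rmorph_sum cphi _ _ _)); apply: eq_bigr => i _.
      apply: (etrans (rmorph_sum cphi _ _ _)); apply: eq_bigr => j _.
      exact: (rmorphM cphi).
    rewrite rmorph_sum; apply: eq_bigr => i _ /=; rewrite mulrC mpolyCM; congr (_ * _).
    by rewrite rmorph_sum; apply: eq_bigr => j _; rewrite /= mpolyCM mulrC.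
  have E1 : \sum_k' kz (k == k')%:R%:MP * (e k')%:MP = (e k)%:MP.
    rewrite (bigD1 k) //= eqxx rmorph1 mul1r big1 ?addr0 // => k'.
    by rewrite eq_sym => /negbTE ->; rewrite mpolyC0 rmorph0 mul0r.
  have kzN k' : kz (N k k') =
      kz (M k k') - kz ((M k k').@[matrix_point a])%:MP + kz (k == k')%:R%:MP.
    by rewrite [LHS](rmorphD kz) (rmorphB kz).
  under eq_bigr do rewrite kzN mulrDl mulrBl.
  by rewrite big_split /= E1 sumrB [X in _ - X]Ea subrK.
have HNN (k : mon) : H (kz (\det NN) * (e k)%:MP).
  have -> : kz (\det NN) = \det (map_mx kz NN) by rewrite det_map_mx.
  rewrite -(enum_rankK k).
  apply: (@det_mul_ideal _ H _ (map_mx kz NN) (fun i => (e (enum_val i))%:MP)) => // i.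
  have := HN (enum_val i).
  rewrite (reindex (fun j : 'I_#|{: mon}| => enum_val j)) /=; last exact/onW_bij/enum_val_bij.
  by under [X in _ -> H X]eq_bigr do rewrite !mxE.
exists (\det NN); last first.
  rewrite -(det_map_mx (meval (matrix_point a))) (_ : map_mx _ _ = 1%:M) ?det1 ?oner_neq0 //.
  apply/matrixP => i j; rewrite !mxE /= /N mevalD mevalB !mevalC subrr add0r.
  by rewrite (inj_eq enum_val_inj).
exists n.+1 => y /fiber_plus_ext_pow.
apply: (ideal_gen_sub (P := fun z => H (kz (\det NN) * z))).
  split; first by rewrite mulr0; case: iH.
  by move=> b x x' h h'; rewrite mulrDr mulrCA; case: iH => _; apply.
move=> _ [m dm ->].
have lt : (mdeg m < n.+2)%N by rewrite dm.
by have := HNN (BMultinom lt); rewrite /e /= dm eqxx.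
Qed.

End DegreeCover.
End Elimination.

(** * Reductions *)

(** Among the matrices whose row space lies in [W], one of maximal rank works: a vector of [W]
    outside it would raise the rank. *)
Lemma subspace_row_space (K : fieldType) (u : nat) (W : 'rV[K]_u -> Prop) :
  W 0 -> (forall c v w, W v -> W w -> W (c *: v + w)) ->
  exists a : 'M[K]_u, forall v, W v <-> (v <= a)%MS.
Proof.
move=> W0 WD.
pose has_rank r := `[< exists2 a : 'M[K]_u, forall v, (v <= a)%MS -> W v & \rank a = r >].
have ex0 : exists r, has_rank r.
  exists 0%N; apply/asboolP; exists 0; last exact: mxrank0.
  by move=> v; rewrite submx0 => /eqP ->.
have bound r : has_rank r -> (r <= u)%N.
  by move=> /asboolP[a _ <-]; apply: rank_leq_row.
have [r /asboolP[a aW ra] rmax] := ex_maxnP ex0 bound.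
exists a => v; split; last exact: aW.
move=> Wv; apply: contrapT => /negP va.
have /rmax : has_rank (\rank (a + v)%MS).
  apply/asboolP; exists (a + v)%MS => // w /sub_addsmxP[[w1 w2] /= ->].
  rewrite addrC (mx11_scalar w2) mul_scalar_mx; apply: WD => //.
  by apply: aW; apply: submxMl.
rewrite leqNgt -ra => /negP; apply; apply: rank_ltmx.
by rewrite /ltmx addsmxSl /=; apply: contraNN va; apply: submx_trans; apply: addsmxSr.
Qed.

Section Reduction.
Variables (K : fieldType) (d u delta : nat) (f : 'I_u -> 'X_{1..d}).
Hypothesis f_degree : forall j, mdeg (f j) = delta.

Local Notation R := {mpoly K[d]}.
Local Notation T := {mpoly K[u]}.
Local Notation I := (mono_ideal K f).
Local Notation mm := (max_ideal K d).
Local Notation phi := (@fiber_scalar K d I).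
Local Notation g := (@fiber_gen K d u f).
Local Notation ev := (mmap phi g).
Local Notation evm := (@ev_mono K d u f).

Variable J : R -> Prop.
Hypothesis J_homog : is_homogeneous_ideal J.
Hypothesis J_red : is_reduction I J.

Lemma mono_ideal_order p : I p -> order_ge delta p.
Proof.
apply: ideal_gen_sub; first exact: order_ge_ideal.
by move=> _ [j ->]; rewrite -(f_degree j); apply: order_geX.
Qed.

Lemma max_ideal_order p : mm p -> order_ge 1 p.
Proof.
apply: ideal_gen_sub; first exact: order_ge_ideal.
by move=> _ [i ->]; rewrite -(mdeg1 i); apply: order_geX.
Qed.

Lemma max_mono_ideal_order p : ideal_mul mm (ideal_pow I 1) p -> order_ge delta.+1 p.
Proof.
apply: ideal_gen_sub; first exact: order_ge_ideal.
move=> _ [x [y [/max_ideal_order ox Iy ->]]]; rewrite -add1n; apply: order_geM => //.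
apply: ideal_gen_sub Iy; first exact: order_ge_ideal.
move=> _ [y' [z [/mono_ideal_order oy _ ->]]].
by rewrite mulrC; apply: (is_ideal_mull _ (@order_ge_ideal K d delta)).
Qed.

Lemma ev_mono_lin_homog (v : 'rV[K]_u) : evm (lin_form v 0) \is delta.-homog.
Proof.
rewrite rmorph_sum; apply: dhomog_sum => j _ /=; rewrite ev_monoZ ev_monoXU.
by apply: dhomogZ; rewrite dhomogX /= f_degree.
Qed.

Lemma lin_form_mulmx s s' (C : 'M[K]_(s', s)) (a : 'M[K]_(s, u)) i :
  lin_form (C *m a) i = \sum_k C i k *: lin_form a k.
Proof.
under eq_bigr do rewrite scaler_sumr; rewrite exchange_big; apply: eq_bigr => j _.
by rewrite mxE scaler_suml; apply: eq_bigr => k _; rewrite scalerA.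
Qed.

Lemma dhomog1_lin_form (Q : T) : Q \is 1.-homog -> exists v : 'rV[K]_u, Q = lin_form v 0.
Proof.
move=> /dhomogP hQ; exists (\row_j Q@_U_(j)); apply/mpolyP => m.
rewrite raddf_sum /=; have [m1|m1] := eqVneq (mdeg m) 1%N; last first.
  rewrite memN_msupp_eq0; last by apply: contraNN m1 => /hQ ->.
  rewrite big1 // => j _; rewrite mcoeffZ mcoeffX; case: eqP => [E|_]; last by rewrite mulr0.
  by rewrite -E mdeg1 eqxx in m1.
have /mdeg1P[j /eqP ->] : mdeg m == 1%N by rewrite m1.
rewrite (bigD1 j) //= mcoeffZ mcoeffXU eqxx mulr1 mxE big1 ?addr0 // => i /negbTE ij.
by rewrite mcoeffZ mcoeffXU ij mulr0.
Qed.

(** The row space of [a] parametrizes the degree [delta] part of [J]. *)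
Lemma reduction_rows : exists a : 'M[K]_u, forall v : 'rV[K]_u,
  J (evm (lin_form v 0)) <-> (v <= a)%MS.
Proof.
have [iJ _] := J_homog; apply: subspace_row_space.
  rewrite /lin_form big1 ?rmorph0; first by case: iJ.
  by move=> j _; rewrite mxE scale0r.
move=> c v w Jv Jw; have -> : lin_form (c *: v + w) 0 = c *: lin_form v 0 + lin_form w 0.
  rewrite scaler_sumr -big_split; apply: eq_bigr => j _.
  by rewrite !mxE scalerDl scalerA.
rewrite rmorphD /= ev_monoZ -mul_mpolyC; apply: is_idealD => //; exact: is_ideal_mull.
Qed.

Section Rows.
Variable a : 'M[K]_u.
Hypothesis a_rows : forall v : 'rV[K]_u, J (evm (lin_form v 0)) <-> (v <= a)%MS.

(** An element of [I] is congruent modulo [m I] to a combination of the [f_j]. As [m I] starts in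
    degree [delta.+1], this combination is the component of degree [delta], which lies in [J] by
    homogeneity. *)
Lemma reduction_mod_max p : J p -> exists w : 'I_u -> K,
  ideal_mul mm (ideal_pow I 1) (p - evm (\sum_i w i *: lin_form a i)).
Proof.
have [iJ Jpi] := J_homog; have [_ JI _] := J_red => Jp.
have [Q /dhomog1_lin_form[v ->] pQ] := ideal_pow_ev_mono (ideal_pow1 (JI _ Jp)).
have /a_rows /submxP[D Ev] : J (evm (lin_form v 0)).
  suff -> : evm (lin_form v 0) = pihomog mdeg delta p by apply: Jpi.
  rewrite -[p](subrK (evm (lin_form v 0))) pihomogD order_ge_pihomog ?add0r.
    by rewrite pihomog_dE // ev_mono_lin_homog.
  exact: max_mono_ideal_order.
by exists (D 0); rewrite -lin_form_mulmx -Ev.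
Qed.

(** In the equality of [I^(n+1)] with [J I^n], factors from [J] are replaced modulo [m I] by
    combinations of the rows, and factors from [I^n] modulo [m I^n] by forms of degree [n]; the
    errors lie in [m I^(n+1)] and vanish in the fiber ring. *)
Lemma reduction_spanned : exists n, degree_in_span phi g n.+1 a.
Proof.
have [iJ JI [n hn]] := J_red; exists n => m dm.
pose D x := exists2 Q : 'I_u -> T, forall i, Q i \is n.-homog &
  ideal_mul mm (ideal_pow I n.+1) (x - evm (\sum_i Q i * lin_form a i)).
have hX : 'X_[K, m] \is n.+1.-homog by rewrite dhomogX /= dm.
have : ideal_mul J (ideal_pow I n) (evm 'X_[m]).
  by apply/(hn n (leqnn n)); apply: ev_mono_pow.
have imul := ideal_mul_ideal mm (ideal_pow I n.+1).
suff JD x : ideal_mul J (ideal_pow I n) x -> D x.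
  move=> /JD[Q hQ Qx]; exists (fun i => ev (Q i)).
  apply/eqP; rewrite -subr_eq0; apply/eqP.
  have E : ev ('X_[m] - \sum_i Q i * lin_form a i) = 0.
    apply: (@ev_dhomog_eq0 _ _ _ _ n.+1); last by rewrite rmorphB.
    rewrite rpredB //; apply: dhomog_sum => i _; rewrite -addn1.
    by apply: dhomogM => //; apply: lin_form_homog.
  rewrite -[RHS]E rmorphB rmorph_sum; congr (_ - _); apply: eq_bigr => i _.
  by rewrite rmorphM /= ev_lin_form.
move=> [k [b [y [hy ->]]]]; elim/big_ind: _ => [|x1 x2 [Q hQ Qx] [S hS Sy]|i _].
- exists (fun=> 0) => [i|]; first exact: dhomog0.
  by rewrite big1 ?rmorph0 ?subrr => [|i _]; [apply: ideal_mul_eq0 | rewrite mul0r].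
- exists (fun i => Q i + S i) => [i|]; first exact: dhomogD.
  have -> : \sum_i (Q i + S i) * lin_form a i =
      \sum_i Q i * lin_form a i + \sum_i S i * lin_form a i.
    by rewrite -big_split; apply: eq_bigr => i _; rewrite mulrDl.
  by rewrite rmorphD opprD addrACA; apply: is_idealD.
have [p [q [Jp Iq ->]]] := hy i; rewrite mulrA.
have [w Hw] := reduction_mod_max (is_ideal_mull (b i) iJ Jp).
have [Q hQ Qq] := ideal_pow_ev_mono Iq.
exists (fun i => w i *: Q); first by move=> j; apply: dhomogZ.
set L := \sum_i w i *: lin_form a i in Hw.
have -> : \sum_i w i *: Q * lin_form a i = L * Q.
  by rewrite mulr_suml; apply: eq_bigr => j _; rewrite -!scalerAl mulrC.
have -> : b i * p * q - evm (L * Q) = q * (b i * p - evm L) + evm L * (q - evm Q).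
  by rewrite rmorphM /=; ring.
apply: is_idealD => //.
  by have := ideal_mul_pow Iq Hw; rewrite addn1.
apply: (@ideal_mul_pow _ I 1 n) => //; apply: ev_mono_pow; apply: rpred_sum => j _.
by apply: dhomogZ; apply: lin_form_homog.
Qed.

End Rows.
End Reduction.

(** * Specialization of the generic forms into a homogeneous reduction *)

Theorem theorem5p4 (K : fieldType) (K_infinite : forall s : seq K, exists x, x \notin s)
  (d u delta : nat) (f : 'I_u -> 'X_{1..d})
  (f_degree : forall j, mdeg (f j) = delta)
  (I_nonzero : exists2 p : {mpoly K[d]}, mono_ideal K f p & p != 0)
  (l : nat) (l_spread : analytic_spread_is (mono_ideal K f) l)
  (h : {mpoly K[l * u]}) (h_irreducible : irreducible_elt h)
  (h_generates : ideal_eq (A_ideal K l f) (ideal_gen (eq h))) :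
  forall r : {mpoly K[d]},
    colon_sat (mono (J_ideal K l f)) (ideal_gen (eq h%:MP_[d])) (R_to_Rz u l r) ->
    gradedcore (mono_ideal K f) r.
Proof.
move=> r [N hN] J J_homog J_red; have [iJ _] := J_homog.
have [a a_rows] := reduction_rows f J_homog.
have [n a_span] := reduction_spanned f_degree J_homog J_red a_rows.
have [C [n' Ca_span]] := noether_normalization (@ev_surj K d u f) (@ev_homog K d u f)
  K_infinite l_spread a_span.
have [c Ac cn0] := elimination_nonvanishing Ca_span.
set pt := matrix_point _ in cn0.
(* The element [c] of [A] is a multiple of [h], so [h] cannot vanish where [c] does not. *)
have hpt : h.@[pt] != 0.
  have [k [b [q [hq Ec]]]] := (h_generates c).1 Ac.
  apply: contra_neq cn0 => h0; rewrite Ec rmorph_sum big1 // => i _.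
  by rewrite rmorphM /= -(hq i) h0 mulr0.
(* [sigma] sets [z] to [C *m a]; the rows of this product lie in the row space of [a], so each [b_i]
   is sent into [J]. *)
pose sigma := map_mpoly (meval pt) : {mpoly {mpoly K[l * u]}[d]} -> {mpoly K[d]}.
pose P x := J (sigma x).
have iP : is_ideal P.
  split; first by rewrite /P /sigma rmorph0; case: iJ.
  by move=> b x y; rewrite /P /sigma rmorphD rmorphM; case: iJ => _; apply.
have JP x : J_ideal K l f x -> P x.
  apply: ideal_gen_sub => // _ [i ->].
  rewrite /P; have -> : sigma (J_gen K f i) = ev_mono f (lin_form (row i (C *m a)) 0).
    rewrite /sigma !rmorph_sum; apply: eq_bigr => j _.
    rewrite rmorphM /= map_mpolyC map_mpolyX /zvar /= mevalXU /pt /matrix_point.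
    by rewrite mxvecE ev_monoZ ev_monoXU mul_mpolyC [row i _ 0 j]mxE.
  by apply/a_rows; rewrite row_mul; apply: submxMl.
have monoP x : mono (J_ideal K l f) x -> P x.
  by apply: ideal_gen_sub => // y [/JP].
have hpow k : ideal_pow (ideal_gen (eq h%:MP_[d])) k (h%:MP ^+ k).
  elim: k => [|k IH] //; rewrite exprS; apply: mem_ideal_mul => //.
  exact: mem_ideal_gen.
(* Specializing [r] times the [N]-th power of [h] leaves [r] unchanged and turns the power into a
   nonzero constant, which can be divided out. *)
have := monoP _ (hN _ (hpow N)); rewrite /P /sigma rmorphM rmorphXn /= map_mpolyC.
have -> : map_mpoly (meval pt) (R_to_Rz u l r) = r.
  by apply/mpolyP => m; rewrite !mcoeff_map_mpoly /= mevalC.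
rewrite mulrC -rmorphXn => /(is_ideal_mull ((h.@[pt] ^+ N)^-1)%:MP iJ).
by rewrite mulrA -mpolyCM mulVf ?expf_neq0 // mpolyC1 mul1r.
Qed.
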